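(* Let $n \geq 2$. The map $\mathbb{C}S_n \to \bigoplus_{\lambda \in \overline{\mathcal{P}}(n)} \operatorname{End}(W^\lambda)$, $\sigma \mapsto \bigoplus_{\lambda \in \overline{\mathcal{P}}(n)} W^\lambda(\sigma)$, induces a superalgebra isomorphism $$\mathbb{C}S_n \cong \Big[ \bigoplus_{\lambda \in E_n} Q(W^\lambda) \Big] \oplus \Big[ \bigoplus_{\lambda \in F_n} \operatorname{End}(W^\lambda) \Big] \cong \Big[ \bigoplus_{\lambda \in E_n} Q(f^\lambda) \Big] \oplus \Big[ \bigoplus_{\lambda \in F_n} M\big(\tfrac{1}{2}f^\lambda \,\big|\, \tfrac{1}{2}f^\lambda\big) \Big],$$ where $f^\lambda = \dim(S^\lambda)$.
   Context: All vector spaces are over $\mathbb{C}$; ''super'' means $\mathbb{Z}_2$-graded, $V=V_{\overline 0}\oplus V_{\overline 1}$. The group algebra $\mathbb{C}S_n$ is a superalgebra with even part $\mathbb{C}A_n$ and odd part the span of the odd permutations. For a superalgebra $A$, $|A|$ denotes $A$ as an ordinary (ungraded) algebra. For a partition $\lambda$ of $n$, $\lambda'$ is the conjugate (transpose) partition and $S^\lambda$ is the Specht module (a simple $|\mathbb{C}S_n|$-module). $\overline{\mathcal{P}}(n)$ is a fixed set of representatives for the classes $\{\lambda,\lambda'\}$ of partitions of $n$, with $(n)\in\overline{\mathcal{P}}(n)$; $E_n = \{\lambda\in\overline{\mathcal{P}}(n):\lambda\neq\lambda'\}$ and $F_n=\{\lambda\in\overline{\mathcal{P}}(n):\lambda=\lambda'\}$.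 For each $\lambda\vdash n$ fix a linear isomorphism $\phi^\lambda:S^\lambda\to S^{\lambda'}$ with $\phi^\lambda(\sigma v)=\operatorname{sgn}(\sigma)\,\sigma\phi^\lambda(v)$ for all $\sigma\in S_n$, $v\in S^\lambda$, chosen so that $\phi^{\lambda'}\circ\phi^\lambda=\mathrm{id}_{S^\lambda}$. For $\lambda=\lambda'$, let $S^{\lambda^+}$, $S^{\lambda^-}$ be the $+1$ and $-1$ eigenspaces of $\phi^\lambda$ (simple, non-isomorphic $\mathbb{C}A_n$-modules). $W^\lambda$ is the following simple $\mathbb{C}S_n$-supermodule. For $\lambda\in E_n$: $W^\lambda=S^\lambda\oplus S^{\lambda'}$ as a $|\mathbb{C}S_n|$-module, with $W^\lambda_{\overline0}=\{u+\phi^\lambda(u):u\in S^\lambda\}$, $W^\lambda_{\overline1}=\{u-\phi^\lambda(u):u\in S^\lambda\}$, and it carries the odd involution $J^\lambda$ given by $J^\lambda(u\pm\phi^\lambda(u))=u\mp\phi^\lambda(u)$ for $u\in S^\lambda$. For $\lambda\in F_n$: $W^\lambda=S^\lambda$ as a $|\mathbb{C}S_n|$-module, with $W^\lambda_{\overline0}=S^{\lambda^+}$, $W^\lambda_{\overline1}=S^{\lambda^-}$. $W^\lambda(\sigma)\in\operatorname{End}(W^\lambda)$ is the map $w\mapsto\sigma w$. $\operatorname{End}(V)$ is the superalgebra of all linear endomorphisms of $V$; for $\lambda \in E_n$, $Q(W^\lambda)=\{\theta\in\operatorname{End}(W^\lambda):J^\lambda\circ\theta=\theta\circ J^\lambda\}$.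 $M(m|n)$ is the superalgebra of $(m+n)\times(m+n)$ block matrices $\begin{bmatrix} A & B \\ C & D \end{bmatrix}$ (diagonal blocks, of sizes $m$ and $n$, even; off-diagonal blocks odd), and $Q(m)$ is the subsuperalgebra of $M(m|m)$ of matrices of the form $\begin{bmatrix} A & B \\ B & A \end{bmatrix}$. *)

(* Defs.v *)
From HB Require Import structures.
From mathcomp Require Import all_boot all_order all_algebra all_fingroup.
From mathcomp Require Export reals complex.

Set Implicit Arguments.
Unset Strict Implicit.
Unset Printing Implicit Defensive.

Import Order.TTheory GRing.Theory Num.Theory.
Local Open Scope ring_scope.

Lemma linfunE_cond (K : fieldType) (U V : vectType K) (f : U -> V) :
  linear f -> linfun f =1 f.
Proof.
move=> lf; pose F := GRing.isLinear.Build K U V _ f lf.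
pose g : {linear U -> V} := HB.pack f F.
exact: (lfunE g).
Qed.

(* Degrees are booleans: false is even, true is odd. *)
Record superspace (K : fieldType) := Superspace {
  sp_vect :> vectType K;
  sp_gr : bool -> {vspace sp_vect};
  sp_add : (sp_gr false + sp_gr true = fullv)%VS;
  sp_cap : (sp_gr false :&: sp_gr true = 0)%VS
}.

Arguments sp_gr {K} V b : rename.

(* Not based on algType, which excludes the zero ring: it occurs here as an
   empty direct sum and as End(0). *)
Record superalg (K : fieldType) := Superalg {
  sa_mod :> lmodType K;
  sa_mul : sa_mod -> sa_mod -> sa_mod;
  sa_one : sa_mod;
  sa_gr : bool -> {pred sa_mod};
  sa_mulA : associative sa_mul;
  sa_mul1 : left_id sa_one sa_mul;
  sa_mulr1 : right_id sa_one sa_mul;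
  sa_mull : forall y, linear (sa_mul^~ y);
  sa_mulr : forall x, linear (sa_mul x);
  sa_gr_submod : forall b, submod_closed (sa_gr b);
  sa_gr_dec : forall x, exists2 y, y \in sa_gr false & x - y \in sa_gr true;
  sa_gr_cap : forall x, x \in sa_gr false -> x \in sa_gr true -> x = 0;
  sa_gr1 : sa_one \in sa_gr false;
  sa_grM : forall a b x y, x \in sa_gr a -> y \in sa_gr b ->
    sa_mul x y \in sa_gr (a (+) b)
}.

Arguments sa_one {K} A : rename.
Arguments sa_gr {K} A b : rename.

Definition superalg_iso (K : fieldType) (A B : superalg K) (f : A -> B) : Prop :=
  [/\ linear f, f (sa_one A) = sa_one B,
      forall x y, f (sa_mul x y) = sa_mul (f x) (f y),
      forall b x, x \in sa_gr A b -> f x \in sa_gr B b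
    & bijective f].

Record subsuperalg (K : fieldType) (A : superalg K) := Subsuperalg {
  ssa_pred : {pred A};
  ssa_submod : submod_closed ssa_pred;
  ssa_one : sa_one A \in ssa_pred;
  ssa_mul : forall x y, x \in ssa_pred -> y \in ssa_pred ->
    sa_mul x y \in ssa_pred;
  ssa_gr : forall x, x \in ssa_pred -> exists y,
    [/\ y \in ssa_pred, y \in sa_gr A false & x - y \in sa_gr A true]
}.

HB.instance Definition _ (K : fieldType) (A : superalg K) (S : subsuperalg A) :=
  GRing.isSubmodClosed.Build K A (ssa_pred S) (ssa_submod S).

Record ssa_type (K : fieldType) (A : superalg K) (S : subsuperalg A) :=
  SsaElt { ssa_val : A; _ : ssa_val \in ssa_pred S }.

HB.instance Definition _ K A S := [isSub for @ssa_val K A S].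
HB.instance Definition _ K A S := [Choice of @ssa_type K A S by <:].
HB.instance Definition _ K A S := [SubChoice_isSubZmodule of @ssa_type K A S by <:].
HB.instance Definition _ K A S := [SubZmodule_isSubLmodule of @ssa_type K A S by <:].

Section SubSuperalgebra.
Variables (K : fieldType) (A : superalg K) (S : subsuperalg A).
Implicit Types x y : ssa_type S.

Lemma ssa_mul_subproof x y : sa_mul (ssa_val x) (ssa_val y) \in ssa_pred S.
Proof. exact: ssa_mul (valP x) (valP y). Qed.

Let mul x y : ssa_type S := SsaElt (ssa_mul_subproof x y).
Let one : ssa_type S := SsaElt (ssa_one S).
Let gr b : {pred ssa_type S} := [pred x | ssa_val x \in sa_gr A b].

Lemma ssa_mulA : associative mul.
Proof. by move=> x y z; apply: val_inj; apply: sa_mulA. Qed.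
Lemma ssa_mul1 : left_id one mul.
Proof. by move=> x; apply: val_inj; apply: sa_mul1. Qed.
Lemma ssa_mulr1 : right_id one mul.
Proof. by move=> x; apply: val_inj; apply: sa_mulr1. Qed.
Lemma ssa_mull y : linear (mul^~ y).
Proof. by move=> a x z; apply: val_inj; apply: sa_mull. Qed.
Lemma ssa_mulr x : linear (mul x).
Proof. by move=> a y z; apply: val_inj; apply: sa_mulr. Qed.
Lemma ssa_gr_submod b : submod_closed (gr b).
Proof.
have [h0 hl] := sa_gr_submod A b.
by split=> [|a x y gx gy]; rewrite inE; [apply: h0 | apply: hl].
Qed.
Lemma ssa_gr_dec x : exists2 y, y \in gr false & x - y \in gr true.
Proof.
by have [y [Sy g0 g1]] := ssa_gr (valP x); exists (SsaElt Sy); rewrite inE.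
Qed.
Lemma ssa_gr_cap x : x \in gr false -> x \in gr true -> x = 0.
Proof. by rewrite !inE => g0 g1; apply: val_inj; apply: sa_gr_cap. Qed.
Lemma ssa_gr1 : one \in gr false. Proof. by rewrite inE sa_gr1. Qed.
Lemma ssa_grM a b x y : x \in gr a -> y \in gr b -> mul x y \in gr (a (+) b).
Proof. by rewrite !inE; apply: sa_grM. Qed.

Definition sub_superalg : superalg K :=
  Superalg ssa_mulA ssa_mul1 ssa_mulr1 ssa_mull ssa_mulr ssa_gr_submod
    ssa_gr_dec ssa_gr_cap ssa_gr1 ssa_grM.
End SubSuperalgebra.

Section DirectSum2.
Variables (K : fieldType) (A B : superalg K).
Let mul (x y : A * B) : A * B := (sa_mul x.1 y.1, sa_mul x.2 y.2).
Let one : A * B := (sa_one A, sa_one B).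
Let gr b : {pred (A * B)%type} :=
  [pred x | (x.1 \in sa_gr A b) && (x.2 \in sa_gr B b)].

Lemma ds2_mulA : associative mul.
Proof. by move=> x y z; rewrite /mul !sa_mulA. Qed.
Lemma ds2_mul1 : left_id one mul.
Proof. by case=> x y; rewrite /mul !sa_mul1. Qed.
Lemma ds2_mulr1 : right_id one mul.
Proof. by case=> x y; rewrite /mul !sa_mulr1. Qed.
Lemma ds2_mull y : linear (mul^~ y).
Proof. by move=> a x z; congr (_, _); apply: sa_mull. Qed.
Lemma ds2_mulr x : linear (mul x).
Proof. by move=> a y z; congr (_, _); apply: sa_mulr. Qed.
Lemma ds2_gr_submod b : submod_closed (gr b).
Proof.
have [hA0 hA] := sa_gr_submod A b; have [hB0 hB] := sa_gr_submod B b.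
split=> [|a x y]; rewrite !inE; first by rewrite hA0 hB0.
by move=> /andP[? ?] /andP[? ?]; rewrite hA ?hB.
Qed.
Lemma ds2_gr_dec x : exists2 y, y \in gr false & x - y \in gr true.
Proof.
have [y1 h1 k1] := sa_gr_dec x.1; have [y2 h2 k2] := sa_gr_dec x.2.
by exists (y1, y2); rewrite inE /= ?h1 ?h2 ?k1 ?k2.
Qed.
Lemma ds2_gr_cap x : x \in gr false -> x \in gr true -> x = 0.
Proof.
case: x => x1 x2; rewrite !inE /= => /andP[? ?] /andP[? ?].
by congr (_, _); apply: sa_gr_cap.
Qed.
Lemma ds2_gr1 : one \in gr false. Proof. by rewrite inE !sa_gr1. Qed.
Lemma ds2_grM a b x y : x \in gr a -> y \in gr b -> mul x y \in gr (a (+) b).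
Proof. by rewrite !inE /= => /andP[? ?] /andP[? ?]; rewrite !sa_grM. Qed.

Definition dsum2 : superalg K :=
  Superalg ds2_mulA ds2_mul1 ds2_mulr1 ds2_mull ds2_mulr ds2_gr_submod
    ds2_gr_dec ds2_gr_cap ds2_gr1 ds2_grM.
End DirectSum2.

Definition dsum_type (K : fieldType) (I : finType) (A : I -> superalg K) : Type :=
  {dffun forall i : I, A i}.

HB.instance Definition _ (K : fieldType) (I : finType) (A : I -> superalg K) :=
  Choice.on (dsum_type A).

Section DirectSumModule.
Variables (K : fieldType) (I : finType) (A : I -> superalg K).
Implicit Types x y : dsum_type A.

Let zero : dsum_type A := [ffun i => (0 : A i)].
Let opp x : dsum_type A := [ffun i => - x i].
Let add x y : dsum_type A := [ffun i => x i + y i].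
Let scale (a : K) x : dsum_type A := [ffun i => a *: x i].

Fact ds_addA : associative add.
Proof. by move=> x y z; apply/ffunP=> i; rewrite !ffunE addrA. Qed.
Fact ds_addC : commutative add.
Proof. by move=> x y; apply/ffunP=> i; rewrite !ffunE addrC. Qed.
Fact ds_add0 : left_id zero add.
Proof. by move=> x; apply/ffunP=> i; rewrite !ffunE add0r. Qed.
Fact ds_addN : left_inverse zero opp add.
Proof. by move=> x; apply/ffunP=> i; rewrite !ffunE addNr. Qed.

HB.instance Definition _ :=
  GRing.isZmodule.Build (dsum_type A) ds_addA ds_addC ds_add0 ds_addN.

Fact ds_scaleA a b x : scale a (scale b x) = scale (a * b) x.
Proof. by apply/ffunP=> i; rewrite !ffunE scalerA. Qed.
Fact ds_scale1 : left_id 1 scale.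
Proof. by move=> x; apply/ffunP=> i; rewrite !ffunE scale1r. Qed.
Fact ds_scaleDr : right_distributive scale +%R.
Proof. by move=> a x y; apply/ffunP=> i; rewrite !ffunE scalerDr. Qed.
Fact ds_scaleDl x : {morph scale^~ x : a b / a + b}.
Proof. by move=> a b; apply/ffunP=> i; rewrite !ffunE scalerDl. Qed.

HB.instance Definition _ := GRing.Zmodule_isLmodule.Build K (dsum_type A)
  ds_scaleA ds_scale1 ds_scaleDr ds_scaleDl.

Lemma dsum_addE x y i : (x + y) i = x i + y i. Proof. exact: ffunE. Qed.
Lemma dsum_oppE x i : (- x) i = - x i. Proof. exact: ffunE. Qed.
Lemma dsum_0E i : (0 : dsum_type A) i = 0. Proof. exact: ffunE. Qed.
Lemma dsum_scaleE a x i : (a *: x) i = a *: x i. Proof. exact: ffunE. Qed.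
End DirectSumModule.

Section DirectSum.
Variables (K : fieldType) (I : finType) (A : I -> superalg K).
Implicit Types x y : dsum_type A.

Let mul x y : dsum_type A := [ffun i => sa_mul (x i) (y i)].
Let one : dsum_type A := [ffun i => sa_one (A i)].
Let gr b : {pred dsum_type A} := [pred x : dsum_type A | [forall i, x i \in sa_gr (A i) b]].

Lemma ds_mulA : associative mul.
Proof. by move=> x y z; apply/ffunP=> i; rewrite !ffunE sa_mulA. Qed.
Lemma ds_mul1 : left_id one mul.
Proof. by move=> x; apply/ffunP=> i; rewrite !ffunE sa_mul1. Qed.
Lemma ds_mulr1 : right_id one mul.
Proof. by move=> x; apply/ffunP=> i; rewrite !ffunE sa_mulr1. Qed.
Lemma ds_mull y : linear (mul^~ y).
Proof.
move=> a x z; apply/ffunP=> i.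
by rewrite !(dsum_addE, dsum_scaleE, ffunE) sa_mull.
Qed.
Lemma ds_mulr x : linear (mul x).
Proof.
move=> a y z; apply/ffunP=> i.
by rewrite !(dsum_addE, dsum_scaleE, ffunE) sa_mulr.
Qed.
Lemma ds_gr_submod b : submod_closed (gr b).
Proof.
split=> [|a x y]; rewrite !inE.
  by apply/forallP=> i; rewrite dsum_0E; case: (sa_gr_submod (A i) b).
move=> /forallP gx /forallP gy; apply/forallP=> i.
by rewrite dsum_addE dsum_scaleE; apply: (sa_gr_submod (A i) b).2.
Qed.
Lemma ds_gr_dec x : exists2 y, y \in gr false & x - y \in gr true.
Proof.
have dec i : exists y : A i, (y \in sa_gr (A i) false)
    && (x i - y \in sa_gr (A i) true).
  by have [y y0 y1] := sa_gr_dec (x i); exists y; rewrite y0.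
pose y : dsum_type A := [ffun i => xchoose (dec i)].
have hy i : (y i \in sa_gr (A i) false) && (x i - y i \in sa_gr (A i) true).
  by rewrite ffunE; apply: (xchooseP (dec i)).
exists y; rewrite inE; apply/forallP=> i; have /andP[h0 h1] := hy i => //.
by rewrite dsum_addE dsum_oppE.
Qed.
Lemma ds_gr_cap x : x \in gr false -> x \in gr true -> x = 0.
Proof.
rewrite !inE => /forallP x0 /forallP x1; apply/ffunP=> i.
by rewrite dsum_0E; apply: sa_gr_cap.
Qed.
Lemma ds_gr1 : one \in gr false.
Proof. by rewrite inE; apply/forallP=> i; rewrite ffunE sa_gr1. Qed.
Lemma ds_grM a b x y : x \in gr a -> y \in gr b -> mul x y \in gr (a (+) b).
Proof.
rewrite !inE => /forallP gx /forallP gy; apply/forallP=> i.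
by rewrite ffunE sa_grM.
Qed.

Definition dsum : superalg K :=
  Superalg ds_mulA ds_mul1 ds_mulr1 ds_mull ds_mulr ds_gr_submod
    ds_gr_dec ds_gr_cap ds_gr1 ds_grM.
End DirectSum.

Section EndSuperalgebra.
Variables (K : fieldType) (V : superspace K).
Implicit Types f g : 'End(V).

Let mul f g : 'End(V) := (f \o g)%VF.
Let one : 'End(V) := \1%VF.
Let gr b : {pred 'End(V)} :=
  [pred f | (f @: sp_gr V false <= sp_gr V b)%VS
         && (f @: sp_gr V true <= sp_gr V (~~ b))%VS].

Lemma end_grP b f :
  reflect (forall a v, v \in sp_gr V a -> f v \in sp_gr V (a (+) b))
          (f \in gr b).
Proof.
apply: (iffP andP) => [[/subvP f0 /subvP f1] [] v Vv | hf] /=.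
- by apply: f1; apply: memv_img.
- by apply: f0; apply: memv_img.
split; apply/subvP=> _ /memv_imgP[v Vv ->].
  exact: (hf false).
exact: (hf true).
Qed.

Lemma end_mulA : associative mul.
Proof. exact: comp_lfunA. Qed.
Lemma end_mul1 : left_id one mul.
Proof. exact: comp_lfun1l. Qed.
Lemma end_mulr1 : right_id one mul.
Proof. exact: comp_lfun1r. Qed.
Lemma end_mull g : linear (mul^~ g).
Proof. by move=> a f h; rewrite /mul comp_lfunDl comp_lfunZl. Qed.
Lemma end_mulr f : linear (mul f).
Proof. by move=> a g h; rewrite /mul comp_lfunDr comp_lfunZr. Qed.
Lemma end_gr_submod b : submod_closed (gr b).
Proof.
split=> [|k f g /end_grP hf /end_grP hg]; apply/end_grP => a v Vv.
  by rewrite zero_lfunE mem0v.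
by rewrite add_lfunE scale_lfunE memvD ?memvZ ?hf ?hg.
Qed.
Lemma sp_gr_cap0 v : v \in sp_gr V false -> v \in sp_gr V true -> v = 0.
Proof. by move=> v0 v1; apply/eqP; rewrite -memv0 -(sp_cap V) memv_cap v0. Qed.

Let p b : 'End(V) := daddv_pi (sp_gr V b) (sp_gr V (~~ b)).
Let cap0 b : (sp_gr V b :&: sp_gr V (~~ b) = 0)%VS.
Proof. by case: b; rewrite /= ?(sp_cap V) // capvC (sp_cap V). Qed.
Let pE a b v : v \in sp_gr V a -> p b v = if a == b then v else 0.
Proof.
case: eqP => [-> | /eqP nab] Va; first exact: (daddv_pi_id (cap0 b)).
have Vnb : v \in sp_gr V (~~ b) by move: Va; case: (a) (b) nab => [] [].
have := daddv_pi_add (cap0 b) (w := v).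
rewrite (daddv_pi_id _ Vnb); last by rewrite capvC cap0.
move=> h; apply: (addIr v); rewrite add0r; apply: h.
by apply: (subvP (addvSr _ _)).
Qed.
Let pmem b v : p b v \in sp_gr V b. Proof. exact: memv_pi. Qed.
Let padd v : p false v + p true v = v.
Proof. by apply: (daddv_pi_add (cap0 false)); rewrite /= sp_add memvf. Qed.

Lemma end_gr_dec f : exists2 g, g \in gr false & f - g \in gr true.
Proof.
pose g : 'End(V) := (p false \o f \o p false)%VF + (p true \o f \o p true)%VF.
exists g; apply/end_grP=> a v Va; rewrite ?addbF ?addbT.
  rewrite add_lfunE !comp_lfunE !(pE _ Va).
  by case: (a); rewrite /= !linear0 ?addr0 ?add0r pmem.
rewrite add_lfunE opp_lfunE add_lfunE !comp_lfunE !(pE _ Va).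
have {1}<- := padd (f v).
by case: (a); rewrite /= !linear0 ?addr0 ?add0r ?addrK ?pmem // addrC addKr pmem.
Qed.
Lemma end_gr_cap f : f \in gr false -> f \in gr true -> f = 0.
Proof.
move=> /end_grP f0 /end_grP f1; apply/lfunP=> v; rewrite zero_lfunE.
have h a w : w \in sp_gr V a -> f w = 0.
  move=> Vw; have := f0 a w Vw; have := f1 a w Vw; rewrite addbF addbT.
  by case: (a) => ? ?; apply: sp_gr_cap0.
by rewrite -(padd v) linearD /= !(h _ _ (pmem _ _)) addr0.
Qed.
Lemma end_gr1 : one \in gr false.
Proof. by apply/end_grP=> a v Vv; rewrite id_lfunE addbF. Qed.
Lemma end_grM a b f g : f \in gr a -> g \in gr b -> mul f g \in gr (a (+) b).
Proof.
move=> /end_grP hf /end_grP hg; apply/end_grP => c v Vv.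
by rewrite comp_lfunE addbC [a (+) b]addbC addbC addbA; apply/hf/hg.
Qed.

Definition End_superalg : superalg K :=
  Superalg end_mulA end_mul1 end_mulr1 end_mull end_mulr end_gr_submod
    end_gr_dec end_gr_cap end_gr1 end_grM.
End EndSuperalgebra.

Record odd_involution (K : fieldType) (V : superspace K) := OddInvolution {
  oi_fun : 'End(V);
  oi_inv : (oi_fun \o oi_fun = \1)%VF;
  oi_odd : oi_fun \in sa_gr (End_superalg V) true
}.

Section QueerEnd.
Variables (K : fieldType) (V : superspace K) (J : odd_involution V).
Let comm : {pred End_superalg V} :=
  [pred f : 'End(V) | (oi_fun J \o f == f \o oi_fun J)%VF].

Lemma qend_submod : submod_closed comm.
Proof.
split=> [|a f g]; rewrite !inE; first by rewrite comp_lfun0r comp_lfun0l.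
move=> /eqP hf /eqP hg; apply/eqP.
by rewrite comp_lfunDr comp_lfunDl -comp_lfunZr -comp_lfunZl hf hg.
Qed.
Lemma qend_one : sa_one (End_superalg V) \in comm.
Proof. by rewrite inE comp_lfun1l comp_lfun1r. Qed.
Lemma qend_mul f g : f \in comm -> g \in comm ->
  sa_mul (f : End_superalg V) g \in comm.
Proof.
rewrite !inE /= => /eqP hf /eqP hg; apply/eqP.
by rewrite comp_lfunA hf -comp_lfunA hg comp_lfunA.
Qed.
Lemma qend_gr f : f \in comm -> exists g,
  [/\ g \in comm, g \in sa_gr (End_superalg V) false
    & f - g \in sa_gr (End_superalg V) true].
Proof.
rewrite inE => /eqP hf; have [g g0 g1] := sa_gr_dec (f : End_superalg V).
exists g; split=> //; rewrite inE -subr_eq0; apply/eqP.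
have sub b (x y : End_superalg V) : x \in sa_gr _ b -> y \in sa_gr _ b ->
    x - y \in sa_gr _ b.
  by move=> hx hy; rewrite -scaleN1r addrC; apply: (sa_gr_submod _ b).2.
set D : End_superalg V := (_ - _)%R.
apply: (@sa_gr_cap _ _ D).
  have -> : D = ((f - g) \o oi_fun J)%VF - (oi_fun J \o (f - g))%VF.
    rewrite comp_lfunDl comp_lfunDr comp_lfunNl comp_lfunNr hf.
    by rewrite opprD addrACA subrr add0r opprK addrC.
  apply: sub; first exact: (sa_grM g1 (oi_odd J)).
  exact: (sa_grM (oi_odd J) g1).
apply: sub; first exact: (sa_grM (oi_odd J) g0).
exact: (sa_grM g0 (oi_odd J)).
Qed.

Definition QEnd_sub : subsuperalg (End_superalg V) :=
  Subsuperalg qend_submod qend_one qend_mul qend_gr.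
Definition QEnd_superalg : superalg K := sub_superalg QEnd_sub.
End QueerEnd.

Section SubmxLinear.
Variables (K : fieldType) (m n : nat).
Implicit Types X Y : 'M[K]_(m + n).

Lemma ulsubmx_linear : linear (fun X => ulsubmx X).
Proof. by move=> a X Y; rewrite /ulsubmx !linearP. Qed.
Lemma ursubmx_linear : linear (fun X => ursubmx X).
Proof. by move=> a X Y; rewrite /ursubmx !linearP. Qed.
Lemma dlsubmx_linear : linear (fun X => dlsubmx X).
Proof. by move=> a X Y; rewrite /dlsubmx !linearP. Qed.
Lemma drsubmx_linear : linear (fun X => drsubmx X).
Proof. by move=> a X Y; rewrite /drsubmx !linearP. Qed.

Definition submx_linear :=
  (ulsubmx_linear, ursubmx_linear, dlsubmx_linear, drsubmx_linear).

Lemma submx0 : (ulsubmx (0 : 'M[K]_(m + n)) = 0) * (ursubmx (0 : 'M[K]_(m + n)) = 0)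
  * (dlsubmx (0 : 'M[K]_(m + n)) = 0) * (drsubmx (0 : 'M[K]_(m + n)) = 0).
Proof. by rewrite /ulsubmx /ursubmx /dlsubmx /drsubmx !linear0. Qed.
End SubmxLinear.

Section MatSuperalgebra.
Variables (K : fieldType) (m n : nat).
Local Notation M := 'M[K]_(m + n).
Implicit Types X Y : M.
Let gr b : {pred M} := [pred X : M |
  if b then (ulsubmx X == 0) && (drsubmx X == 0)
  else (ursubmx X == 0) && (dlsubmx X == 0)].

Lemma mat_mull Y : linear (mulmx^~ Y : M -> M).
Proof. by move=> a X Z; rewrite mulmxDl scalemxAl. Qed.
Lemma mat_mulr X : linear (mulmx X : M -> M).
Proof. by move=> a Y Z; rewrite mulmxDr scalemxAr. Qed.
Lemma mat_gr_submod b : submod_closed (gr b).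
Proof.
case: b; split=> [|a X Y]; rewrite !inE ?submx0 ?eqxx //=
    => /andP[/eqP h1 /eqP h2] /andP[/eqP h3 /eqP h4];
  by rewrite !submx_linear h1 h2 h3 h4 !scaler0 !addr0 !eqxx.
Qed.
Lemma mat_gr_dec X : exists2 Y, Y \in gr false & X - Y \in gr true.
Proof.
exists (block_mx (ulsubmx X) 0 0 (drsubmx X)).
  by rewrite inE block_mxKur block_mxKdl !eqxx.
by rewrite inE addrC -scaleN1r !submx_linear block_mxKul block_mxKdr !scaleN1r
  !addNr !eqxx.
Qed.
Lemma mat_gr_cap X : X \in gr false -> X \in gr true -> X = 0.
Proof.
rewrite !inE => /andP[/eqP h1 /eqP h2] /andP[/eqP h3 /eqP h4].
by rewrite -[X]submxK h1 h2 h3 h4 block_mx0.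
Qed.
Lemma mat_gr1 : (1%:M : M) \in gr false.
Proof. by rewrite inE scalar_mx_block block_mxKur block_mxKdl !eqxx. Qed.
Lemma mat_grM a b X Y : X \in gr a -> Y \in gr b -> X *m Y \in gr (a (+) b).
Proof.
rewrite -[X]submxK -[Y]submxK mulmx_block !inE.
rewrite !(block_mxKur, block_mxKdl, block_mxKul, block_mxKdr).
case: a; case: b => /= /andP[/eqP h1 /eqP h2] /andP[/eqP h3 /eqP h4];
  by rewrite h1 h2 h3 h4 !(mul0mx, mulmx0) !addr0 !eqxx.
Qed.

Definition Mat_superalg : superalg K :=
  Superalg (@mulmxA K _ _ _ _) (@mul1mx K _ _) (@mulmx1 K _ _) mat_mull mat_mulr
    mat_gr_submod mat_gr_dec mat_gr_cap mat_gr1 mat_grM.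
End MatSuperalgebra.

Section QueerMat.
Variables (K : fieldType) (m : nat).
Let q : {pred Mat_superalg K m m} := [pred X : 'M[K]_(m + m) |
  (ulsubmx X == drsubmx X) && (ursubmx X == dlsubmx X)].

Lemma qmat_submod : submod_closed q.
Proof.
split=> [|a X Y]; rewrite !inE ?submx0 ?eqxx //.
move=> /andP[/eqP h1 /eqP h2] /andP[/eqP h3 /eqP h4].
by rewrite !submx_linear h1 h2 h3 h4 !eqxx.
Qed.
Lemma qmat_one : sa_one (Mat_superalg K m m) \in q.
Proof.
rewrite inE /= scalar_mx_block block_mxKul block_mxKdr.
by rewrite block_mxKur block_mxKdl !eqxx.
Qed.
Lemma qmat_mul X Y : X \in q -> Y \in q ->
  sa_mul (X : Mat_superalg K m m) Y \in q.
Proof.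
rewrite !inE => /andP[/eqP h1 /eqP h2] /andP[/eqP h3 /eqP h4] /=.
rewrite -[X]submxK -[Y]submxK mulmx_block.
rewrite !(block_mxKur, block_mxKdl, block_mxKul, block_mxKdr) h1 h2 h3 h4.
by apply/andP; split; apply/eqP; rewrite addrC.
Qed.
Lemma qmat_gr X : X \in q -> exists Y,
  [/\ Y \in q, Y \in sa_gr (Mat_superalg K m m) false
    & X - Y \in sa_gr (Mat_superalg K m m) true].
Proof.
rewrite inE => /andP[/eqP h1 /eqP h2].
exists (block_mx (ulsubmx X) 0 0 (drsubmx X) : 'M[K]_(m + m)).
rewrite !inE [X - _]addrC -scaleN1r !submx_linear.
by rewrite !(block_mxKur, block_mxKdl, block_mxKul, block_mxKdr) h1 !scaleN1r
  !addNr !eqxx.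
Qed.

Definition QMat_sub : subsuperalg (Mat_superalg K m m) :=
  Subsuperalg qmat_submod qmat_one qmat_mul qmat_gr.
Definition QMat_superalg : superalg K := sub_superalg QMat_sub.
End QueerMat.

(* MathComp's product s * t in 'S_n means s first, then t; the product of S_n
   for which 'I_n is a left S_n-set is the opposite one. *)
Definition pcomp (n : nat) (s t : 'S_n) : 'S_n := (t * s)%g.

Lemma pcompE (n : nat) (s t : 'S_n) i : pcomp s t i = s (t i).
Proof. exact: permM. Qed.

Section GroupSuperalgebra.
Variables (K : fieldType) (n : nat).
(* x stands for the formal sum of the x s *: s. *)
Local Notation SnA := {ffun 'S_n -> K^o}.
Implicit Types x y : SnA.

Definition SnA_of (s : 'S_n) : SnA := [ffun t => (t == s)%:R].

Let mul x y : SnA :=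
  \sum_(s : 'S_n) \sum_(t : 'S_n) (x s * y t) *: SnA_of (pcomp s t).
Let gr (b : bool) : {pred SnA} :=
  [pred x : SnA | [forall s : 'S_n, (x s != 0) ==> (odd_perm s == b)]].

Let mulE x y u : mul x y u = \sum_(s : 'S_n) x s * y (u * s^-1)%g.
Proof.
rewrite sum_ffunE; apply: eq_bigr => s _; rewrite sum_ffunE.
rewrite (bigD1 (u * s^-1)%g) //= big1 => [|t ne]; last first.
  rewrite !ffunE /pcomp; case: eqP => [e | _]; last by rewrite scaler0.
  by rewrite e mulgK eqxx in ne.
by rewrite !ffunE /pcomp mulgKV eqxx addr0 /GRing.scale /= mulr1.
Qed.

Let supp b x : x \in gr b -> forall s, odd_perm s != b -> x s = 0.
Proof.
by rewrite inE => /forallP h s ns; have := h s; case: eqP => //= _ /eqP e;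
  rewrite e eqxx in ns.
Qed.
Let suppI b x : (forall s, odd_perm s != b -> x s = 0) -> x \in gr b.
Proof.
move=> h; rewrite inE; apply/forallP=> s; apply/implyP; apply: contraNT.
by move/h/eqP.
Qed.

Lemma SnA_mulA : associative mul.
Proof.
move=> x y z; apply/ffunP=> u; rewrite !mulE.
under eq_bigr => s _ do rewrite mulE mulr_sumr.
under [RHS]eq_bigr => s _ do rewrite mulE mulr_suml.
rewrite [RHS]exchange_big /=; apply: eq_bigr => s _.
rewrite [RHS](reindex_inj (mulIg s)) /=; apply: eq_bigr => t _.
by rewrite mulrA mulgK invMg mulgA.
Qed.
Lemma SnA_mul1 : left_id (SnA_of 1) mul.
Proof.
move=> x; apply/ffunP=> u; rewrite mulE (bigD1 1%g) //= big1 => [|s ne].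
  by rewrite ffunE eqxx invg1 mulg1 mul1r addr0.
by rewrite ffunE (negPf ne) mul0r.
Qed.
Lemma SnA_mulr1 : right_id (SnA_of 1) mul.
Proof.
move=> x; apply/ffunP=> u; rewrite mulE (bigD1 u) //= big1 => [|s ne].
  by rewrite ffunE mulgV eqxx mulr1 addr0.
by rewrite ffunE -eq_mulgV1 eq_sym (negPf ne) mulr0.
Qed.
Lemma SnA_mull y : linear (mul^~ y).
Proof.
move=> a x z; apply/ffunP=> u; rewrite !ffunE !mulE scaler_sumr -big_split /=.
by apply: eq_bigr => s _; rewrite !ffunE mulrDl -scalerAl.
Qed.
Lemma SnA_mulr x : linear (mul x).
Proof.
move=> a y z; apply/ffunP=> u; rewrite !ffunE !mulE scaler_sumr -big_split /=.
by apply: eq_bigr => s _; rewrite !ffunE mulrDr /GRing.scale /= mulrCA.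
Qed.
Lemma SnA_gr_submod b : submod_closed (gr b).
Proof.
split=> [|a x y /supp hx /supp hy]; apply: suppI => s ns; rewrite !ffunE //.
by rewrite hx // hy // scaler0 addr0.
Qed.
Lemma SnA_gr_dec x : exists2 y, y \in gr false & x - y \in gr true.
Proof.
exists [ffun s : 'S_n => if odd_perm s then 0 else x s]; apply: suppI => s;
  rewrite !ffunE; first by case: odd_perm.
by case: odd_perm => // _; rewrite subrr.
Qed.
Lemma SnA_gr_cap x : x \in gr false -> x \in gr true -> x = 0.
Proof.
move=> /supp h0 /supp h1; apply/ffunP=> s; rewrite ffunE.
by case e: (odd_perm s); [apply: h0 | apply: h1]; rewrite e.
Qed.
Lemma SnA_gr1 : SnA_of 1 \in gr false.
Proof.
by apply: suppI => s; rewrite ffunE; case: (eqVneq s 1%g) => // ->; rewrite odd_perm1.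
Qed.
Lemma SnA_grM a b x y : x \in gr a -> y \in gr b -> mul x y \in gr (a (+) b).
Proof.
move=> /supp hx /supp hy; apply: suppI => u nu; rewrite mulE big1 // => s _.
case: (eqVneq (odd_perm s) a) => [e | /hx ->]; last by rewrite mul0r.
rewrite hy ?mulr0 // odd_permM odd_permV e; apply: contra nu => /eqP <-.
by rewrite addbCA addbb addbF.
Qed.

Definition Sn_superalg : superalg K :=
  Superalg SnA_mulA SnA_mul1 SnA_mulr1 SnA_mull SnA_mulr SnA_gr_submod
    SnA_gr_dec SnA_gr_cap SnA_gr1 SnA_grM.
End GroupSuperalgebra.

Record Sn_supermodule (K : fieldType) (n : nat) := SnSupermodule {
  sm_space :> superspace K;
  sm_act : 'S_n -> 'End(sm_space);
  sm_act1 : sm_act 1%g = \1%VF;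
  sm_actM : forall s t, sm_act (pcomp s t) = (sm_act s \o sm_act t)%VF;
  sm_odd : forall s b v, v \in sp_gr sm_space b ->
    sm_act s v \in sp_gr sm_space (b (+) odd_perm s)
}.

(* The parts in nonincreasing order, padded with zeros to length n. *)
Definition is_intpart (n : nat) (f : {ffun 'I_n -> 'I_n.+1}) : bool :=
  [forall i : 'I_n, forall j : 'I_n, (i <= j)%N ==> (f j <= f i)%N]
  && (\sum_(i < n) f i == n)%N.

Record intpart (n : nat) := IntPart {
  ipart :> {ffun 'I_n -> 'I_n.+1};
  _ : is_intpart ipart
}.

HB.instance Definition _ n := [isSub for @ipart n].
HB.instance Definition _ n := [Finite of intpart n by <:].

Section Partitions.
Variable n : nat.

Definition conj_fun (la : intpart n) : {ffun 'I_n -> 'I_n.+1} :=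
  [ffun j : 'I_n => inord #|[set i : 'I_n | j < la i]|%N].

Lemma conj_intpart la : is_intpart (conj_fun la).
Proof.
have cE (j : 'I_n) : conj_fun la j = #|[set i : 'I_n | j < la i]%N| :> nat.
  by rewrite ffunE inordK // ltnS -[leqRHS](card_ord n) max_card.
have /andP[_ /eqP sumla] := valP la; apply/andP; split.
  apply/forallP=> i; apply/forallP=> j; apply/implyP=> le_ij; rewrite !cE.
  apply/subset_leq_card/subsetP=> k; rewrite !inE; exact: leq_ltn_trans.
apply/eqP; rewrite -[RHS]sumla.
under eq_bigr => j _ do rewrite cE cardsE -sum1_card big_mkcond /=.
rewrite exchange_big /=; apply: eq_bigr => i _.
rewrite -big_mkcond /= sum1_card.
have le_la : (la i <= n)%N by rewrite -ltnS ltn_ord.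
transitivity #|[set widen_ord le_la k | k : 'I_(la i)]|.
  apply: eq_card => j; rewrite unfold_in; apply/idP/imsetP=> [lt | [k _ ->]].
    by exists (Ordinal lt) => //; apply: val_inj.
  exact: ltn_ord k.
by rewrite card_imset ?card_ord // => k l /(congr1 val) /= /val_inj.
Qed.

Definition conj_part (la : intpart n) : intpart n := IntPart (conj_intpart la).

Definition row_fun : {ffun 'I_n -> 'I_n.+1} :=
  [ffun i : 'I_n => if val i == 0%N then ord_max else ord0].

Lemma row_intpart : is_intpart row_fun.
Proof.
apply/andP; split.
  apply/forallP=> i; apply/forallP=> j; apply/implyP=> le_ij; rewrite !ffunE.
  case: (val j =P 0) => [j0 | _] //.
  by have -> : val i == 0%N; rewrite ?leqnn // -leqn0 -[leqRHS]j0.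
rewrite /row_fun; case: n => [|m]; first by rewrite big_ord0.
rewrite big_ord_recl big1 => [|i _]; rewrite !ffunE //=.
by rewrite addn0.
Qed.

Definition row_part : intpart n := IntPart row_intpart.

Definition conj_transversal (Pbar : {set intpart n}) : Prop :=
  (forall la, #|Pbar :&: [set la; conj_part la]| = 1%N) /\ row_part \in Pbar.

End Partitions.

Definition Epart n (Pbar : {set intpart n}) : {set intpart n} :=
  [set la in Pbar | conj_part la != la].
Definition Fpart n (Pbar : {set intpart n}) : {set intpart n} :=
  [set la in Pbar | conj_part la == la].

Section Specht.
Variables (K : fieldType) (n : nat).

(* A tableau is encoded by the (row, column) positions of its entries: being
   injective into the diagram, which has n cells, it is a bijection. *)
Definition is_tableau (la : intpart n) (t : {ffun 'I_n -> 'I_n * 'I_n}) : bool :=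
  injectiveb t && [forall x, ((t x).2 < la (t x).1)%N].

(* A tabloid is encoded by the map giving the row of each entry; all the
   permutation modules M^la are thus spanned by basis vectors of one space. *)
Definition tabloid : finType := {ffun 'I_n -> 'I_n}.
Definition tabloid_space : vectType K := {ffun tabloid -> K^o}.

Definition tabloid_vec (r : tabloid) : tabloid_space := [ffun r' => (r' == r)%:R].

(* s maps the basis vector r to r \o s^-1, so (s v) r = v (r \o s). *)
Definition tabloid_act (s : 'S_n) : 'End(tabloid_space) :=
  linfun (fun v : tabloid_space =>
    [ffun r : tabloid => v [ffun x => r (s x)]] : tabloid_space).

(* The tabloid {s t}, where s t has s x in the cell in which t has x. *)
Definition tab_rows (s : 'S_n) (t : {ffun 'I_n -> 'I_n * 'I_n}) : tabloid :=
  [ffun x => (t (s^-1%g x)).1].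

Definition col_stab (t : {ffun 'I_n -> 'I_n * 'I_n}) : {set 'S_n} :=
  [set s : 'S_n | [forall x, (t (s x)).2 == (t x).2]].

Definition polytabloid (t : {ffun 'I_n -> 'I_n * 'I_n}) : tabloid_space :=
  \sum_(s in col_stab t) (-1) ^+ odd_perm s *: tabloid_vec (tab_rows s t).

Definition specht (la : intpart n) : {vspace tabloid_space} :=
  <<[seq polytabloid t | t <- enum (is_tableau la)]>>%VS.

Definition specht_mod (la : intpart n) : vectType K := subvs_of (specht la).

Definition specht_act (la : intpart n) (s : 'S_n) : 'End(specht_mod la) :=
  linfun (fun u : specht_mod la =>
    vsproj (specht la) (tabloid_act s (vsval u)) : specht_mod la).

Lemma tabloid_actE s (v : tabloid_space) r :
  tabloid_act s v r = v [ffun x => r (s x)].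
Proof.
rewrite linfunE_cond ?ffunE // => a u w.
by apply/ffunP=> r'; rewrite !ffunE.
Qed.

Lemma tabloid_act1 v : tabloid_act 1 v = v.
Proof.
apply/ffunP=> r; rewrite tabloid_actE; congr (v _).
by apply/ffunP=> x; rewrite ffunE perm1.
Qed.

Lemma tabloid_actM s t v :
  tabloid_act (pcomp s t) v = tabloid_act s (tabloid_act t v).
Proof.
apply/ffunP=> r; rewrite !tabloid_actE; congr (v _).
by apply/ffunP=> x; rewrite !ffunE pcompE.
Qed.

Lemma tabloid_act_polytabloid s t :
  tabloid_act s (polytabloid t) = polytabloid [ffun x => t (s^-1%g x)].
Proof.
pose t' : {ffun 'I_n -> 'I_n * 'I_n} := [ffun x => t (s^-1%g x)].
rewrite -/t' /polytabloid linear_sum /=.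
rewrite [RHS](reindex_inj (conjg_inj s)) /=.
have uJ (u : 'S_n) x : s^-1%g ((u ^ s)%g x) = u (s^-1%g x).
  by rewrite -{1}(permKV s x) permJ permK.
apply: eq_big => [u | u _].
  rewrite !inE; apply/forallP/forallP=> h x.
    by have := h (s^-1%g x); rewrite !ffunE uJ.
  by have := h (s x); rewrite !ffunE uJ permK.
rewrite linearZ odd_permJ; congr (_ *: _); apply/ffunP=> r.
rewrite tabloid_actE !ffunE; congr (nat_of_bool _)%:R.
apply/eqP/eqP=> /ffunP h; apply/ffunP=> x.
  by have := h (s^-1%g x); rewrite !ffunE permKV -conjVg uJ.
by have := h (s x); rewrite !ffunE -conjVg uJ permK.
Qed.

Lemma specht_stable la s v : v \in specht la -> tabloid_act s v \in specht la.
Proof.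
suff h : (tabloid_act s @: specht la <= specht la)%VS.
  by move=> Sv; apply: (subvP h); apply: memv_img.
rewrite /specht limg_span; apply/span_subvP=> _ /mapP[_ /mapP[t ht ->] ->].
rewrite tabloid_act_polytabloid memv_span //; apply: map_f.
move: ht; rewrite !mem_enum => /andP[/injectiveP ti /forallP td].
apply/andP; split; last by apply/forallP=> x; rewrite ffunE.
by apply/injectiveP=> x y; rewrite !ffunE => /ti /perm_inj.
Qed.

Lemma specht_actE la s u :
  vsval (specht_act la s u) = tabloid_act s (vsval u).
Proof.
rewrite linfunE_cond ?vsprojK ?specht_stable ?subvsP // => a v w.
by rewrite !linearP.
Qed.

Lemma specht_act1 la : specht_act la 1 = \1%VF.
Proof.
by apply/lfunP=> u; apply: val_inj; rewrite /= specht_actE tabloid_act1 id_lfunE.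
Qed.

Lemma specht_actM la s t :
  specht_act la (pcomp s t) = (specht_act la s \o specht_act la t)%VF.
Proof.
apply/lfunP=> u; apply: val_inj.
by rewrite /= comp_lfunE !specht_actE tabloid_actM.
Qed.

(* S^la'' and S^la are only propositionally equal, so phi^la' \o phi^la = id
   is stated in the ambient space. *)
Record sgn_isos := SgnIsos {
  phi : forall la, 'Hom(specht_mod la, specht_mod (conj_part la));
  phi_bij : forall la, bijective (phi la);
  phi_sgn : forall la s v, phi la (specht_act la s v) =
    (-1) ^+ odd_perm s *: specht_act (conj_part la) s (phi la v);
  phiK : forall la v, vsval (phi (conj_part la) (phi la v)) = vsval v
}.

End Specht.

Section SuperSpecht.
Variables (K : numFieldType) (n : nat) (ph : sgn_isos K n).
Implicit Type la : intpart n.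

Definition WE_vect la : vectType K :=
  (specht_mod K la * specht_mod K (conj_part la))%type.

(* u + phi u for b = false and u - phi u for b = true, in S^la (+) S^la'. *)
Definition WE_gr la (b : bool) : {vspace WE_vect la} :=
  limg (linfun (fun u : specht_mod K la =>
    (u, (-1) ^+ b *: phi ph la u) : WE_vect la)).

Lemma WE_grP la (b : bool) (w : WE_vect la) :
  reflect (w.2 = (-1) ^+ b *: phi ph la w.1) (w \in WE_gr la b).
Proof.
have lin : linear (fun u : specht_mod K la =>
    (u, (-1) ^+ b *: phi ph la u) : WE_vect la).
  move=> a u v; congr (_, _).
  by rewrite linearP /= scalerDr !scalerA mulrC.
apply: (iffP memv_imgP) => [[u _ ->] | e]; first by rewrite linfunE_cond.
exists w.1; rewrite ?memvf // linfunE_cond //.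
by case: w e => w1 w2 /= ->.
Qed.

Let two_unit : (2%:R : K) \is a GRing.unit.
Proof. by rewrite unitfE pnatr_eq0. Qed.

Lemma WE_add la : (WE_gr la false + WE_gr la true = fullv)%VS.
Proof.
apply/eqP; rewrite eqEsubv subvf; apply/subvP=> -[u v] _.
have [psi K1 K2] := phi_bij ph la.
pose x := 2%:R^-1 *: (u + psi v); pose y := 2%:R^-1 *: (u - psi v).
apply/memv_addP; exists (x, phi ph la x); first by apply/WE_grP; rewrite /= expr0 scale1r.
exists (y, - phi ph la y); first by apply/WE_grP; rewrite /= expr1 scaleN1r.
congr (_, _); rewrite /=.
  rewrite -scalerDr addrACA subrr addr0 -mulr2n -scaler_nat scalerA mulVr //.
  by rewrite scale1r.
rewrite -(linearB (phi ph la)) /= -scalerBr opprB addrC addrA subrK.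
by rewrite -mulr2n -scaler_nat scalerA mulVr // scale1r K2.
Qed.

Lemma WE_cap la : (WE_gr la false :&: WE_gr la true = 0)%VS.
Proof.
apply/eqP; rewrite -subv0; apply/subvP=> -[u v].
rewrite memv_cap => /andP[/WE_grP /= e0 /WE_grP /= e1].
have v0 : v = 0.
  move: e0 e1; rewrite expr0 expr1 scale1r scaleN1r => <- /eqP.
  rewrite -addr_eq0 -mulr2n -scaler_nat scaler_eq0 pnatr_eq0 /=.
  by move/eqP.
have u0 : u = 0.
  apply: (bij_inj (phi_bij ph la)); rewrite linear0 -v0 e0.
  by rewrite expr0 scale1r.
by rewrite u0 v0 memv0.
Qed.

Definition WE_space la : superspace K := Superspace (WE_add la) (WE_cap la).

Definition WE_act la (s : 'S_n) : 'End(WE_space la) :=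
  linfun (fun w : WE_vect la =>
    (specht_act K la s w.1, specht_act K (conj_part la) s w.2) : WE_vect la).

Lemma WE_actE la s (w : WE_vect la) : WE_act la s w =
  (specht_act K la s w.1, specht_act K (conj_part la) s w.2).
Proof. by rewrite linfunE_cond // => a u v; congr (_, _); rewrite /= linearP. Qed.

Lemma WE_act1 la : WE_act la 1 = \1%VF.
Proof.
apply/lfunP=> -[u v]; rewrite WE_actE !specht_act1 /=.
by rewrite !id_lfunE.
Qed.

Lemma WE_actM la s t : WE_act la (pcomp s t) = (WE_act la s \o WE_act la t)%VF.
Proof.
apply/lfunP=> w; rewrite comp_lfunE !WE_actE !specht_actM /=.
by rewrite !comp_lfunE.
Qed.

Lemma WE_odd la s b (w : WE_vect la) : w \in sp_gr (WE_space la) b ->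
  WE_act la s w \in sp_gr (WE_space la) (b (+) odd_perm s).
Proof.
move=> /WE_grP e; apply/WE_grP; rewrite WE_actE /= e phi_sgn scalerA.
by rewrite signr_addb -mulrA -signr_addb addbb mulr1 linearZ.
Qed.

Definition WE la : Sn_supermodule K n :=
  SnSupermodule (WE_act1 la) (@WE_actM la) (@WE_odd la).

(* Equivalently, u +/- phi u is sent to u -/+ phi u. *)
Definition WE_J la : 'End(WE_space la) :=
  linfun (fun w : WE_vect la => (w.1, - w.2) : WE_vect la).

Lemma WE_JE la (w : WE_vect la) : WE_J la w = (w.1, - w.2).
Proof.
by rewrite linfunE_cond // => a u v; congr (_, _); rewrite /= opprD scalerN.
Qed.

Lemma WE_J_inv la : (WE_J la \o WE_J la = \1)%VF.
Proof.
by apply/lfunP=> -[u v]; rewrite comp_lfunE !WE_JE id_lfunE /= opprK.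
Qed.

Lemma WE_J_odd la : WE_J la \in sa_gr (End_superalg (WE_space la)) true.
Proof.
apply/end_grP=> b w /WE_grP e; apply/WE_grP.
by rewrite WE_JE /= e addbT; case: b {e} => /=;
  rewrite ?expr0 ?expr1 ?scale1r ?scaleN1r ?opprK.
Qed.

Definition WEJ la : odd_involution (WE la) :=
  OddInvolution (WE_J_inv la) (WE_J_odd la).

(* The eigenspaces of phi^la for 1 (b = false) and -1 (b = true). For
   la = la' both sides of the eigenvector equation lie in S^la, a subspace of
   the common ambient space. *)
Definition WF_gr la (b : bool) : {vspace specht_mod K la} :=
  lker (linfun (fun u : specht_mod K la =>
    vsval (phi ph la u) - (-1) ^+ b *: vsval u)).

Lemma WF_grP la (b : bool) (u : specht_mod K la) :
  reflect (vsval (phi ph la u) = (-1) ^+ b *: vsval u) (u \in WF_gr la b).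
Proof.
rewrite memv_ker linfunE_cond ?subr_eq0; first exact: eqP.
have vP mu (x y : specht_mod K mu) a :
  vsval (a *: x + y) = a *: vsval x + vsval y by [].
move=> a v w; rewrite (linearP (phi ph la)) !vP scalerBr scalerDr !scalerA.
by rewrite (mulrC a) opprD addrACA.
Qed.

Section SelfConj.
Variables (la : intpart n) (sc : conj_part la == la).

Let S_eq : specht K (conj_part la) = specht K la.
Proof. by rewrite (eqP sc). Qed.

Lemma WF_phiK (u w : specht_mod K la) :
  vsval w = vsval (phi ph la u) -> vsval (phi ph la w) = vsval u.
Proof.
move=> e; rewrite -(phiK ph u).
have h mu (v : specht_mod K mu) : mu = la -> vsval w = vsval v ->
    vsval (phi ph la w) = vsval (phi ph mu v).
  by move=> ml; case: _ / (esym ml) v => v /val_inj ->.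
exact: h (eqP sc) e.
Qed.

Lemma WF_add : (WF_gr la false + WF_gr la true = fullv)%VS.
Proof.
apply/eqP; rewrite eqEsubv subvf; apply/subvP=> u _.
have Sp : vsval (phi ph la u) \in specht K la by rewrite -S_eq subvsP.
pose w : specht_mod K la := vsproj (specht K la) (vsval (phi ph la u)).
have we : vsval w = vsval (phi ph la u) by rewrite vsprojK.
have pw := WF_phiK we.
apply/memv_addP; exists (2%:R^-1 *: (u + w)).
  by apply/WF_grP; rewrite expr0 scale1r !linearZ !linearD /= -we pw addrC.
exists (2%:R^-1 *: (u - w)).
  have vB mu (x y : specht_mod K mu) a :
    vsval (a *: (x - y)) = a *: (vsval x - vsval y) by [].
  apply/WF_grP; rewrite expr1 scaleN1r (linearZZ (phi ph la)).
  by rewrite (linearB (phi ph la)) !vB -we pw -scalerN opprB.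
rewrite -scalerDr addrACA subrr addr0 -mulr2n -scaler_nat scalerA mulVr //.
by rewrite scale1r.
Qed.

Lemma WF_cap : (WF_gr la false :&: WF_gr la true = 0)%VS.
Proof.
apply/eqP; rewrite -subv0; apply/subvP=> u.
rewrite memv_cap => /andP[/WF_grP e0 /WF_grP].
rewrite e0 expr0 expr1 scale1r scaleN1r => /eqP.
rewrite -addr_eq0 -mulr2n -scaler_nat scaler_eq0 pnatr_eq0 /= => /eqP h.
by rewrite memv0; apply/eqP/val_inj.
Qed.

Definition WF_space : superspace K := Superspace WF_add WF_cap.

Lemma WF_odd s b (u : WF_space) : u \in sp_gr WF_space b ->
  specht_act K la s u \in sp_gr WF_space (b (+) odd_perm s).
Proof.
move=> /WF_grP e; apply/WF_grP; rewrite phi_sgn linearZ /= !specht_actE e.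
by rewrite linearZ /= scalerA -signr_addb addbC.
Qed.

Definition WF : Sn_supermodule K n :=
  @SnSupermodule K n WF_space (specht_act K la) (specht_act1 K la)
    (specht_actM K la) WF_odd.
End SelfConj.

Variable Pbar : {set intpart n}.

Definition Eidx : finType := {la : intpart n | la \in Epart Pbar}.
Definition Fidx : finType := {la : intpart n | la \in Fpart Pbar}.

Lemma Fidx_conj (i : Fidx) : conj_part (val i) == val i.
Proof. by have := valP i; rewrite inE => /andP[]. Qed.

(* The index set Pbar is written as the disjoint union of E_n and F_n. *)
Definition W (i : Eidx + Fidx) : Sn_supermodule K n :=
  match i with
  | inl e => WE (val e)
  | inr f => WF (Fidx_conj f)
  end.

Definition EndW : superalg K :=
  dsum (fun i : (Eidx + Fidx)%type => End_superalg (W i)).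

Definition W_map (s : 'S_n) : EndW :=
  finfun (fun i => sm_act (W i) s : End_superalg (W i)).

Definition QEndW : superalg K :=
  dsum2 (dsum (fun e : Eidx => QEnd_superalg (WEJ (val e))))
        (dsum (fun f : Fidx => End_superalg (WF (Fidx_conj f)))).

Definition QEndW_incl (x : QEndW) : EndW :=
  finfun (fun i : Eidx + Fidx =>
    match i return End_superalg (W i) with
    | inl e => ssa_val ((x.1 : dsum_type _) e)
    | inr f => (x.2 : dsum_type _) f
    end).

Definition QMatW : superalg K :=
  dsum2 (dsum (fun e : Eidx => QMat_superalg K (\dim (specht K (val e)))))
        (dsum (fun f : Fidx => Mat_superalg K (\dim (specht K (val f)))./2
                                              (\dim (specht K (val f)))./2)).

End SuperSpecht.

(* Main.v *)
(* Over an algebraically closed field of characteristic 0 the representations of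
   S_n on the Specht modules are pairwise non-isomorphic and irreducible (the
   signed column sum of a tableau t maps S^la onto the line of e_t), and there
   are at least as many of them as conjugacy classes, since the cycle type
   determines the class. By Wedderburn theory the group algebra is therefore the
   product of all the End(S^la). A pair la <> la' contributes End(S^la) x
   End(S^la'), which is the centralizer of J on W^la = S^la (+) S^la'; a
   self-conjugate la contributes End(W^la). The matrix forms come from
   homogeneous bases: J carries an even basis to an odd one, and for la = la' a
   transposition exchanges the two homogeneous parts, so they have dimension
   f^la / 2. *)
Require Import Defs.
From HB Require Import structures.
From mathcomp Require Import all_boot all_order all_algebra all_fingroup.
From mathcomp Require Import pgroup mxrepresentation.
From mathcomp Require Import reals complex.

Set Implicit Arguments.
Unset Strict Implicit.
Unset Printing Implicit Defensive.

Import Order.TTheory GRing.Theory Num.Theory.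
Local Open Scope ring_scope.

(** * Partitions and tableaux *)

Section Diagrams.
Variable n : nat.
Implicit Types (la mu : intpart n) (t : {ffun 'I_n -> 'I_n * 'I_n}).

Definition diagram la : {set 'I_n * 'I_n} := [set p : 'I_n * 'I_n | (p.2 < la p.1)%N].

Lemma part_sum la : (\sum_i la i = n)%N.
Proof. by have /andP[_ /eqP] := valP la. Qed.

Lemma part_mono la (i j : 'I_n) : (i <= j)%N -> (la j <= la i)%N.
Proof. by have /andP[/forallP/(_ i)/forallP/(_ j)/implyP] := valP la. Qed.

Lemma card_ord_lt k : (k <= n)%N -> #|[set j : 'I_n | j < k]%N| = k.
Proof.
move=> kn; have wI : injective (widen_ord kn) by move=> i j /(congr1 val) /= /val_inj.
rewrite -[RHS]card_ord -(card_imset _ wI); apply: eq_card => j; rewrite inE.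
apply/idP/imsetP => [jk | [i _ ->]]; last exact: (ltn_ord i).
by exists (Ordinal jk); last apply: val_inj.
Qed.

Lemma part_le la i : (la i <= n)%N.
Proof. by rewrite -ltnS ltn_ord. Qed.

Lemma card_diagram la : #|diagram la| = n.
Proof.
rewrite -[RHS](part_sum la) -sum1_card.
under eq_bigl => p do rewrite inE.
rewrite -(pair_big_dep predT (fun i j : 'I_n => (j < la i)%N) (fun _ _ => 1)%N) /=.
by apply: eq_bigr => i _; rewrite sum1_card -cardsE card_ord_lt ?part_le.
Qed.

Lemma tableauP la t :
  reflect (injective t /\ forall x, t x \in diagram la) (is_tableau la t).
Proof.
apply: (iffP andP) => -[/injectiveP ti].
  by move/forallP=> h; split=> // x; rewrite inE.
by move=> h; split=> //; apply/forallP => x; have := h x; rewrite inE.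
Qed.

Lemma tableau_imset la t : is_tableau la t -> t @: [set: 'I_n] = diagram la.
Proof.
move=> /tableauP[ti td]; apply/eqP; rewrite eqEcard card_imset // cardsT card_ord.
by rewrite card_diagram leqnn andbT; apply/subsetP=> _ /imsetP[x _ ->].
Qed.

Lemma tableau_exists la : exists t, is_tableau la t.
Proof.
have e : #|'I_n| = #|diagram la| by rewrite card_diagram card_ord.
exists [ffun x => enum_val (cast_ord e (enum_rank x))]; apply/tableauP; split.
  by move=> x y; rewrite !ffunE => /enum_val_inj/cast_ord_inj/enum_rank_inj.
by move=> x; rewrite ffunE enum_valP.
Qed.

(** A tableau is a bijection from the entries to the cells, so it reindexes. The row lengths, column
    lengths and weight are all read off from a tableau in this way. *)
Lemma tableau_big la t (R : Type) (idx : R) (op : Monoid.com_law idx)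
    (P : pred ('I_n * 'I_n)) (F : 'I_n * 'I_n -> R) : is_tableau la t ->
  \big[op/idx]_(x | P (t x)) F (t x) = \big[op/idx]_(p in diagram la | P p) F p.
Proof.
move=> tt; rewrite -(tableau_imset tt) [RHS]big_mkcondr [RHS]big_imset /=.
  by rewrite [LHS]big_mkcond; apply: eq_bigl => x; rewrite inE.
by case/tableauP: tt => ti _ x y _ _ /ti.
Qed.

Lemma tableau_perm la t t' : is_tableau la t -> is_tableau la t' ->
  exists s : 'S_n, forall x, t' (s x) = t x.
Proof.
move=> tt tt'; have [ti _] := tableauP _ _ tt.
have ex x : {y | t' y = t x}.
  apply: sig_eqW; have : t x \in t' @: [set: 'I_n].
    by rewrite (tableau_imset tt') -(tableau_imset tt) imset_f.
  by case/imsetP => y _ ->; exists y.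
pose f x := sval (ex x); have fE x : t' (f x) = t x := svalP (ex x).
have fi : injective f by move=> x y e; apply: ti; rewrite -!fE e.
by exists (perm fi) => x; rewrite permE.
Qed.

(** This is the statistic $n(\lambda')=\sum_i\binom{\lambda_i}{2}$. It takes the place of the
    dominance order: any two partitions can be compared by it. *)
Definition weight la : nat := (\sum_(p in diagram la) nat_of_ord p.2)%N.

Lemma weightE la : weight la = (\sum_i \sum_(j : 'I_n | j < la i) j)%N.
Proof.
rewrite /weight; under eq_bigl => p do rewrite inE.
by rewrite -(pair_big_dep predT (fun i j : 'I_n => (j < la i)%N) (fun _ j => nat_of_ord j)).
Qed.

Lemma tableau_weight la t : is_tableau la t -> (\sum_x nat_of_ord (t x).2 = weight la)%N.
Proof.
move=> tt; have := tableau_big _ xpredT (fun p => nat_of_ord p.2) tt => /= ->.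
by apply: eq_bigl => p; rewrite andbT.
Qed.

Lemma tableau_row la t i : is_tableau la t -> #|[set x | (t x).1 == i]| = la i.
Proof.
move=> tt; rewrite cardsE -sum1_card.
rewrite (tableau_big _ (fun p => p.1 == i) (fun=> 1%N) tt).
rewrite -[RHS](card_ord_lt (part_le la i)) -sum1_card.
rewrite (reindex_onto (fun j => (i, j)) (fun p => p.2)) => [|[a b] /andP[_ /eqP <-]] //.
by apply: eq_bigl => j; rewrite !inE !eqxx !andbT.
Qed.

Lemma tableau_col la t j : is_tableau la t ->
  #|[set x | (t x).2 == j]| = conj_part la j.
Proof.
move=> tt; rewrite /= ffunE inordK; last first.
  by rewrite ltnS -[leqRHS](card_ord n) max_card.
rewrite cardsE -sum1_card (tableau_big _ (fun p => p.2 == j) (fun=> 1%N) tt).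
rewrite -[RHS]sum1_card.
rewrite (reindex_onto (fun i => (i, j)) (fun p => p.1)) => [|[a b] /andP[_ /eqP <-]] //.
by apply: eq_bigl => i; rewrite !inE !eqxx !andbT.
Qed.

(** The rows of length greater than [j] form an initial segment, so [i < conj_part la j] holds
    exactly when [j < la i]. Counting the [j] gives back the part [la i]. *)
Lemma conj_partK : involutive (@conj_part n).
Proof.
have cE la (j : 'I_n) : conj_part la j = #|[set i : 'I_n | j < la i]%N| :> nat.
  by rewrite /= ffunE inordK // ltnS -[leqRHS](card_ord n) max_card.
move=> la; apply/val_inj/ffunP=> i; apply: val_inj; rewrite /= [LHS]cE.
rewrite -[RHS](card_ord_lt (part_le la i)); apply: eq_card => j; rewrite !inE.
rewrite cE; apply/idP/idP => [lt|ji].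
  rewrite ltnNge; apply/negP=> le; move: lt; rewrite ltnNge => /negP; apply.
  rewrite -[leqRHS](card_ord_lt (ltnW (ltn_ord i))); apply/subset_leq_card/subsetP=> k.
  rewrite !inE => jk; rewrite ltnNge; apply/negP=> /(part_mono la) ik.
  by have := leq_trans jk (leq_trans ik le); rewrite ltnn.
rewrite -[ltnLHS]/(nat_of_ord i) -[leqLHS](card_ord_lt (ltn_ord i)).
apply/subset_leq_card/subsetP=> k; rewrite !inE ltnS => ki.
exact: leq_trans ji (part_mono la ki).
Qed.

(** The column sizes are the parts of the conjugate partition, and conjugation is injective. *)
Lemma tableau_col_eq la mu t t' : is_tableau la t -> is_tableau mu t' ->
  (forall x, (t x).2 = (t' x).2) -> la = mu.
Proof.
move=> tt tt' e; rewrite -[la]conj_partK -[mu]conj_partK; congr conj_part.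
apply/val_inj/ffunP=> j; apply: val_inj; rewrite /= -!(tableau_col j tt, tableau_col j tt').
by apply: eq_card => x; rewrite !inE e.
Qed.

(** [A] lacks as many elements below [k] as it has elements from [k] on. Exchanging one of the
    former for one of the latter raises the sum by at least 1. *)
Lemma sum_ord_lt (k : nat) (A : {set 'I_n}) : (k <= n)%N -> #|A| = k ->
  (\sum_(j : 'I_n | j < k) j + #|A :\: [set j : 'I_n | j < k]| <= \sum_(j in A) j)%N.
Proof.
move=> kn cA; pose B := [set j : 'I_n | j < k]%N.
have -> : (\sum_(j : 'I_n | j < k) j = \sum_(j in B) j)%N.
  by apply: eq_bigl => j; rewrite inE.
have cB : #|B| = k by apply: card_ord_lt.
have cAB : #|A :\: B| = #|B :\: A|.
  by apply/eqP; rewrite -(eqn_add2l #|A :&: B|) cardsID setIC cardsID cA cB.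
rewrite (big_setID A) [leqRHS](big_setID B) /= setIC -addnA leq_add2l cAB.
rewrite -/B -sum1_card -big_split /= (leq_trans (n := (k * #|A :\: B|)%N)) //.
  rewrite cAB mulnC -sum_nat_const; apply: leq_sum => j.
  by rewrite !inE addn1 => /andP[].
rewrite mulnC -sum_nat_const; apply: leq_sum => j.
by rewrite !inE -leqNgt => /andP[].
Qed.

(* Distinct cells in row [i] have distinct columns, so the columns in a row of
   length k add up to at least 0 + ... + (k - 1), with equality only for the
   left-justified row. *)
Lemma tableau_of_rows mu t : injective t ->
    (forall i, #|[set x | (t x).1 == i]| = mu i) ->
  (weight mu <= \sum_x nat_of_ord (t x).2)%N
  /\ ((\sum_x nat_of_ord (t x).2 <= weight mu)%N -> is_tableau mu t).
Proof.
move=> ti tr; pose A i := [set (t x).2 | x in [set x | (t x).1 == i]].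
have Ainj i : {in [set x | (t x).1 == i] &, injective (fun x => (t x).2)}.
  move=> x y; rewrite !inE => /eqP ex /eqP ey e; apply: ti.
  by rewrite [t x]surjective_pairing [t y]surjective_pairing ex ey e.
have cA i : #|A i| = mu i by rewrite card_in_imset ?tr //; apply: Ainj.
have h i := sum_ord_lt (part_le mu i) (cA i).
have sE : (\sum_x nat_of_ord (t x).2 = \sum_i \sum_(j in A i) j)%N.
  rewrite (partition_big (fun x => (t x).1) xpredT) //=; apply: eq_bigr => i _.
  rewrite big_imset /=; last exact: Ainj.
  by apply: eq_bigl => x; rewrite inE.
(* The defect of row [i]: each cell outside the first [mu i] columns costs at least one unit of
   column sum, so a minimal sum forces every defect to vanish. *)
pose d i := #|A i :\: [set j : 'I_n | j < mu i]%N|.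
have le : (weight mu + \sum_i d i <= \sum_x nat_of_ord (t x).2)%N.
  by rewrite sE weightE -big_split /=; apply: leq_sum => i _; apply: h.
split; first exact: leq_trans (leq_addr _ _) le.
move=> le'; have : (\sum_i d i <= 0)%N.
  by rewrite -(leq_add2l (weight mu)) addn0 (leq_trans le).
rewrite leqn0 sum_nat_eq0 => /forallP d0; apply/tableauP; split=> // x; rewrite inE.
have := d0 (t x).1; rewrite /= cards_eq0 setD_eq0 => /subsetP/(_ (t x).2).
by rewrite inE; apply; apply/imsetP; exists x; rewrite // inE.
Qed.

End Diagrams.

(** * Column antisymmetrizers and the Specht modules *)

Section ColumnAntisymmetrizer.
Variables (K : numFieldType) (n : nat).
Implicit Types (la mu : intpart n) (t : {ffun 'I_n -> 'I_n * 'I_n}).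
Local Notation M := (tabloid_space K n).

(** The signed column sum $\kappa_t$, taken on the whole tabloid space so that it can be applied to
    Specht modules of any shape. *)
Definition col_antisym t (v : M) : M :=
  \sum_(s in col_stab t) (-1) ^+ odd_perm s *: tabloid_act K s v.

Lemma col_antisym_linear t : linear (col_antisym t).
Proof.
move=> a u v; rewrite /col_antisym scaler_sumr -big_split /=; apply: eq_bigr => s _.
by rewrite linearP scalerDr !scalerA mulrC.
Qed.

HB.instance Definition _ t := GRing.isLinear.Build K M M _ _ (col_antisym_linear t).

Definition rows_of t : tabloid n := [ffun x => (t x).1].

Lemma tabloid_act_vec (s : 'S_n) (r : tabloid n) :
  tabloid_act K s (tabloid_vec K r) = tabloid_vec K [ffun x => r (s^-1%g x)].
Proof.
apply/ffunP=> r'; rewrite tabloid_actE !ffunE; congr (nat_of_bool _)%:R.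
apply/eqP/eqP=> [<- | ->]; apply/ffunP=> x; rewrite !ffunE ?permK ?permKV //.
Qed.

Lemma tabloid_vec_sum (v : M) : v = \sum_r v r *: tabloid_vec K r.
Proof.
apply/ffunP=> r; rewrite sum_ffunE (bigD1 r) //= big1 => [|r' /negPf ne].
  by rewrite !ffunE eqxx addr0 /GRing.scale /= mulr1.
by rewrite !ffunE eq_sym ne scaler0.
Qed.

Lemma polytabloidE t : polytabloid K t = col_antisym t (tabloid_vec K (rows_of t)).
Proof.
apply: eq_bigr => s _; rewrite tabloid_act_vec; congr (_ *: tabloid_vec K _).
by apply/ffunP=> x; rewrite !ffunE.
Qed.

Lemma col_stabM t (s u : 'S_n) : s \in col_stab t ->
  ((u * s)%g \in col_stab t) = (u \in col_stab t).
Proof.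
rewrite !inE => /forallP hs; apply: eq_forallb => x.
by rewrite permM (eqP (hs (u x))).
Qed.

Lemma col_stabV t (s : 'S_n) : (s^-1%g \in col_stab t) = (s \in col_stab t).
Proof.
rewrite !inE; apply/forallP/forallP => h x.
  by have := h (s x); rewrite permK eq_sym.
by have := h (s^-1%g x); rewrite permKV eq_sym.
Qed.

Lemma col_antisym_act t (s : 'S_n) v : s \in col_stab t ->
  col_antisym t (tabloid_act K s v) = (-1) ^+ odd_perm s *: col_antisym t v.
Proof.
move=> hs; rewrite /col_antisym scaler_sumr [RHS](reindex_inj (mulgI s)) /=.
apply: eq_big => [u | u _].
  rewrite -[RHS]col_stabV invMg col_stabM ?col_stabV //.
by rewrite scalerA -signr_addb odd_permM addbA addbb addFb -tabloid_actM.
Qed.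

Lemma act_col_antisym t (s : 'S_n) v : s \in col_stab t ->
  tabloid_act K s (col_antisym t v) = (-1) ^+ odd_perm s *: col_antisym t v.
Proof.
move=> hs; rewrite /col_antisym linear_sum scaler_sumr [RHS](reindex_inj (mulIg s)) /=.
apply: eq_big => [u | u _]; first by rewrite col_stabM.
by rewrite linearZ /= scalerA -signr_addb odd_permM addbCA addbb addbF -tabloid_actM.
Qed.

(** Each [s] in the column stabilizer acts on the image of [col_antisym t] by its sign, so every
    term of the sum is the polytabloid itself. In characteristic 0 the factor is invertible. *)
Lemma col_antisym_poly t :
  col_antisym t (polytabloid K t) = #|col_stab t|%:R *: polytabloid K t.
Proof.
rewrite {1}/col_antisym scaler_nat -sumr_const; apply: eq_bigr => s hs.
by rewrite polytabloidE act_col_antisym // scalerA -signr_addb addbb scale1r.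
Qed.

Lemma card_col_stab_neq0 t : #|col_stab t|%:R != 0 :> K.
Proof.
rewrite pnatr_eq0 -lt0n card_gt0; apply/set0Pn; exists 1%g.
by rewrite inE; apply/forallP=> x; rewrite perm1.
Qed.

(** The coefficient at the tabloid of [t] is 1: a permutation that preserves both the row and the
    column of every entry is the identity. *)
Lemma polytabloid_neq0 t : injective t -> polytabloid K t != 0.
Proof.
move=> ti; apply/eqP => /ffunP/(_ (rows_of t)); rewrite sum_ffunE (bigD1 1%g) /=.
  rewrite big1 => [|s /andP[hs s1]].
    rewrite !ffunE odd_perm1 scale1r addr0.
    suff -> : rows_of t == tab_rows 1 t by move/eqP; rewrite oner_eq0.
    by apply/eqP/ffunP=> x; rewrite !ffunE invg1 perm1.
  rewrite !ffunE; case: eqP => [/ffunP e|_]; last by rewrite scaler0.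
  case/eqP: s1; rewrite -[s]invgK; apply/(canLR (@invgK _))/permP => x; rewrite invg1 perm1.
  apply: ti; rewrite [t _]surjective_pairing [RHS]surjective_pairing.
  have := e x; rewrite !ffunE => ->; move: hs; rewrite -col_stabV inE.
  by move=> /forallP/(_ x)/eqP ->.
by rewrite inE; apply/forallP=> x; rewrite perm1.
Qed.

(* If two entries of one column of [t] share a row, their transposition fixes
   the tabloid but is odd. *)
Lemma col_antisym_vec_inj t (r : tabloid n) : col_antisym t (tabloid_vec K r) != 0 ->
  forall x y, r x = r y -> (t x).2 = (t y).2 -> x = y.
Proof.
move=> nz x y rxy txy; apply/eqP; apply: contraNT nz => nxy.
have hs : tperm x y \in col_stab t.
  rewrite inE; apply/forallP=> z.
  by case: tpermP => [->|->|//]; rewrite txy.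
have := col_antisym_act (tabloid_vec K r) hs.
rewrite tabloid_act_vec tpermV odd_tperm nxy expr1 scaleN1r.
have -> : [ffun z => r (tperm x y z)] = r.
  by apply/ffunP=> z; rewrite ffunE; case: tpermP => [->|->|].
move/eqP; rewrite -addr_eq0 -mulr2n -scaler_nat scaler_eq0 pnatr_eq0.
by [].
Qed.

(** All permutation modules share one ambient space, so the fact that $S^\mu$ lies in $M^\mu$ has to
    be recovered: permuting the entries of a tableau keeps its row sizes. *)
Lemma specht_content mu v (r : tabloid n) : v \in specht K mu -> v r != 0 ->
  forall i, #|[set x | r x == i]| = mu i.
Proof.
move=> /coord_span -> nz i; apply/eqP; apply: contraNT nz => ni.
rewrite sum_ffunE big1 // => j _; rewrite ffunE.
have := mem_tnth j (map_tuple [eta polytabloid K (n:=n)] (enum_tuple (is_tableau mu))).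
rewrite (tnth_nth 0).
case/mapP => t; rewrite mem_enum => tt ->.
rewrite sum_ffunE big1 ?scaler0 // => s _; rewrite !ffunE.
case: eqP => [e|_]; last by rewrite scaler0.
case/eqP: ni; rewrite -(tableau_row i tt) e -[LHS](card_imset _ (@perm_inj _ s^-1%g)).
apply: eq_card => x; rewrite inE; apply/imsetP/idP => [[y]|h].
  by rewrite !inE ffunE => h ->.
by exists (s x); rewrite ?permK // inE ffunE permK.
Qed.

Definition set_rows (r : tabloid n) t : {ffun 'I_n -> 'I_n * 'I_n} :=
  [ffun x => (r x, (t x).2)].

(** This replaces the dominance lemma. Since [r] is not annihilated, combining its rows with the
    columns of [t] gives an injective map. Its column sum is the weight of [la], hence at most the
    minimum possible for row sizes [mu]. *)
Lemma set_rows_tableau la mu t (r : tabloid n) : is_tableau la t -> (weight la <= weight mu)%N ->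
    (forall i, #|[set x | r x == i]| = mu i) ->
    col_antisym t (tabloid_vec K r) != 0 ->
  is_tableau mu (set_rows r t).
Proof.
move=> tt lw rmu /col_antisym_vec_inj nz.
apply: (proj2 (tableau_of_rows (mu := mu) (t := set_rows r t) _ _)).
- by move=> x y; rewrite !ffunE => -[]; apply: nz.
- by move=> i; rewrite -rmu; apply: eq_card => x; rewrite !inE ffunE.
rewrite (leq_trans _ lw) // -(tableau_weight tt).
by apply: eq_leq; apply: eq_bigr => x _; rewrite ffunE.
Qed.

Lemma col_antisym_sum t (v : M) :
  col_antisym t v = \sum_r v r *: col_antisym t (tabloid_vec K r).
Proof.
by rewrite {1}[v]tabloid_vec_sum linear_sum; apply: eq_bigr => r _; rewrite linearZ.
Qed.

(** Some tabloid occurring in [v] survives the antisymmetrizer; it yields a tableau of shape [mu]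
    with the same columns as [t], and the columns determine the shape. *)
Lemma col_antisym_specht_neq0 la mu t v : is_tableau la t ->
    (weight la <= weight mu)%N -> v \in specht K mu -> col_antisym t v != 0 ->
  la = mu.
Proof.
move=> tt lw vS; rewrite col_antisym_sum => /eqP nz.
case: (pickP (fun r => (v r != 0) && (col_antisym t (tabloid_vec K r) != 0))).
  move=> r /andP[vr kr]; have tm := set_rows_tableau tt lw (specht_content vS vr) kr.
  by apply: (tableau_col_eq tt tm) => x; rewrite ffunE.
move=> h; case: nz; apply: big1 => r _; have /negbT := h r.
by rewrite negb_and !negbK => /orP[]/eqP ->; rewrite ?scale0r ?scaler0.
Qed.

(** If the image is nonzero, [set_rows r t] is a tableau of the same shape with the same columns as
    [t]. It therefore differs from [t] by a column permutation, which only contributes a sign. *)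
Lemma col_antisym_vec_line la t (r : tabloid n) : is_tableau la t ->
    (forall i, #|[set x | r x == i]| = la i) ->
  exists c, col_antisym t (tabloid_vec K r) = c *: polytabloid K t.
Proof.
move=> tt rla; have [->|nz] := eqVneq (col_antisym t (tabloid_vec K r)) 0.
  by exists 0; rewrite scale0r.
have tm := set_rows_tableau tt (leqnn _) rla nz.
have [s sE] := tableau_perm tm tt.
have hs : s \in col_stab t by rewrite inE; apply/forallP=> x; rewrite sE ffunE.
exists ((-1) ^+ odd_perm s^-1%g).
rewrite polytabloidE -col_antisym_act ?col_stabV // tabloid_act_vec invgK.
congr (col_antisym t (tabloid_vec K _)); apply/ffunP=> x.
by rewrite !ffunE sE ffunE.
Qed.

Lemma col_antisym_line la t v : is_tableau la t -> v \in specht K la ->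
  exists c, col_antisym t v = c *: polytabloid K t.
Proof.
move=> tt vS; have h r : exists c,
    v r *: col_antisym t (tabloid_vec K r) = c *: polytabloid K t.
  (* Only the tabloids that occur in [v] are known to have row sizes [la]. *)
  have [->|nz] := eqVneq (v r) 0; first by exists 0; rewrite !scale0r.
  have [c ->] := col_antisym_vec_line tt (specht_content vS nz).
  by exists (v r * c); rewrite scalerA.
have [c hc] := fin_all_exists h; exists (\sum_r c r).
by rewrite col_antisym_sum scaler_suml; apply: eq_bigr => r _.
Qed.

End ColumnAntisymmetrizer.

(** * Specht modules as irreducible, pairwise non-isomorphic matrix representations *)

Section SpechtRepresentation.
Import VectorInternalTheory.
Variables (C : numClosedFieldType) (n : nat).
Implicit Types (la mu : intpart n) (t : {ffun 'I_n -> 'I_n * 'I_n}) (s : 'S_n).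

Definition end_mx (V : vectType C) (f : 'End(V)) : 'M[C]_(dim V) :=
  lin1_mx (v2r \o f \o r2v).

Lemma end_mxE (V : vectType C) (f : 'End(V)) u : u *m end_mx f = v2r (f (r2v u)).
Proof. exact: mul_rV_lin1. Qed.

Lemma end_mx_linear (V : vectType C) : linear (@end_mx V).
Proof.
move=> a f g; apply/row_matrixP=> i; rewrite !rowE mulmxDr -scalemxAr !end_mxE.
by rewrite add_lfunE scale_lfunE linearP.
Qed.

HB.instance Definition _ (V : vectType C) :=
  GRing.isLinear.Build C 'End(V) 'M[C]_(dim V) _ _ (@end_mx_linear V).

Lemma end_mx_inj (V : vectType C) : injective (@end_mx V).
Proof.
move=> f g e; apply/lfunP=> v; apply: (can_inj v2rK).
by rewrite -[v]v2rK -!end_mxE e.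
Qed.

Definition specht_mx la s := end_mx (specht_act C la s).

(** Matrices act on row vectors from the right, which reverses composition. This matches the product
    of ['S_n], opposite to [pcomp], so that no inverse appears. *)
Lemma specht_mx_repr la : mx_repr [set: 'S_n] (specht_mx la).
Proof.
split=> [|s u _ _]; apply/row_matrixP=> i; rewrite !rowE ?mulmxA !end_mxE.
  by rewrite specht_act1 id_lfunE r2vK mulmx1.
by rewrite v2rK -comp_lfunE -specht_actM.
Qed.

Canonical specht_repr la := MxRepresentation (specht_mx_repr la).

(** Coordinate rows are sent to the common tabloid space, where the results on antisymmetrizers
    apply and different shapes can be compared. *)
Definition row_vec la (u : 'rV[C]_(dim (specht_mod C la))) : tabloid_space C n :=
  vsval (r2v u : specht_mod C la).

Lemma row_vec_linear la : linear (@row_vec la).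
Proof. by move=> a u v; rewrite /row_vec !linearP. Qed.

HB.instance Definition _ la := GRing.isLinear.Build C _ _ _ _ (@row_vec_linear la).

Lemma row_vec_inj la : injective (@row_vec la).
Proof. by move=> u v /val_inj/(can_inj r2vK). Qed.

Lemma row_vec_specht la u : @row_vec la u \in specht C la.
Proof. exact: subvsP. Qed.

Lemma row_vec_surj la v : v \in specht C la -> exists u, @row_vec la u = v.
Proof.
by move=> vS; exists (v2r (vsproj (specht C la) v)); rewrite /row_vec v2rK vsprojK.
Qed.

Lemma row_vec_act la u s : @row_vec la (u *m specht_repr la s) = tabloid_act C s (row_vec u).
Proof. by rewrite /= end_mxE /row_vec v2rK specht_actE. Qed.

Lemma polytabloid_row_vec la t : is_tableau la t ->
  exists2 p, @row_vec la p = polytabloid C t & p != 0.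
Proof.
move=> tt; have [ti _] := tableauP _ _ tt.
have polyS : polytabloid C t \in specht C la.
  by apply: memv_span; apply: map_f; rewrite mem_enum.
have [p ep] := row_vec_surj polyS; exists p => //.
by apply: contraNneq (polytabloid_neq0 C ti) => p0; rewrite -ep p0 linear0.
Qed.

Definition antisym_mx la t : 'M[C]_(dim (specht_mod C la)) :=
  \sum_(s in col_stab t) (-1) ^+ odd_perm s *: specht_repr la s.

Lemma row_vec_antisym la t u : @row_vec la (u *m antisym_mx la t) = col_antisym t (row_vec u).
Proof.
rewrite mulmx_sumr linear_sum; apply: eq_bigr => s _.
by rewrite -scalemxAr linearZ /= row_vec_act.
Qed.

(** The symmetric group permutes the tableaux of a given shape transitively, hence also the
    polytabloids, which span the Specht module. *)
Lemma specht_submodule_full la t (U : 'M_(dim (specht_mod C la))) p :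
  is_tableau la t -> row_vec p = polytabloid C t ->
  mxmodule (specht_repr la) U -> (p <= U)%MS -> row_full U.
Proof.
move=> tt ep /mxmoduleP modU pU.
have polyU t' : is_tableau la t' -> exists2 q, row_vec q = polytabloid C t' & (q <= U)%MS.
  move=> tt'; have [s sE] := tableau_perm tt tt'.
  exists (p *m specht_repr la s); last first.
    by rewrite (submx_trans (submxMr _ pU)) ?modU ?inE.
  rewrite row_vec_act ep tabloid_act_polytabloid; congr (polytabloid C _).
  by apply/ffunP=> x; rewrite ffunE -sE permKV.
rewrite -sub1mx; apply/row_subP=> i; set u := row i _.
have /coord_span e := row_vec_specht u.
have /fin_all_exists2[q qE qU] (j : 'I_#|is_tableau la|) : exists2 q,
    row_vec q = (map_tuple [eta polytabloid C (n:=n)] (enum_tuple (is_tableau la)))`_j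
    & (q <= U)%MS.
  have := mem_tnth j (map_tuple [eta polytabloid C (n:=n)] (enum_tuple (is_tableau la))).
  rewrite (tnth_nth 0) => /mapP [t' tt' ->]; apply: polyU.
  by rewrite mem_enum in tt'.
suff -> : u = \sum_j coord (map_tuple [eta polytabloid C (n:=n)]
    (enum_tuple (is_tableau la))) j (row_vec u) *: q j.
  by rewrite summx_sub // => j _; rewrite scalemx_sub.
apply: row_vec_inj; rewrite {1}e linear_sum; apply: eq_bigr => j _.
by rewrite linearZ /= qE.
Qed.

Lemma pchar_Sym : ([pchar C]^'.-group [set: 'S_n])%g.
Proof. by apply/pgroupP => p _ _; rewrite inE; apply/negP; rewrite pchar_num. Qed.

(* By Maschke a submodule is a summand. The antisymmetrizer maps the Specht
   module onto the line of a polytabloid, so one of the two summands contains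
   that polytabloid, which generates. *)
Lemma specht_irreducible la : mx_irreducible (specht_repr la).
Proof.
have [t tt] := tableau_exists la; have [p ep p0] := polytabloid_row_vec tt.
apply/mx_irrP; split.
  rewrite lt0n; apply: contraNneq p0 => d0; apply/eqP/rowP=> -[j hj].
  by exfalso; move: hj; rewrite d0.
move=> U modU U0.
have [W modW UW dUW] := mx_Maschke_pchar (specht_repr la) pchar_Sym modU (submx1 U).
have : (p <= U + W)%MS by rewrite UW submx1.
case/sub_addsmxP=> -[a b] /= eab.
have line q : exists c, q *m antisym_mx la t = c *: p.
  have [c ec] := col_antisym_line tt (row_vec_specht q).
  by exists c; apply: row_vec_inj; rewrite row_vec_antisym ec linearZ /= ep.
have [c1 e1] := line (a *m U); have [c2 e2] := line (b *m W).
(* The antisymmetrizer applied to the decomposition of [p]: since the left-hand factor is nonzero,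
   [c1] and [c2] cannot both vanish. *)
have e : #|col_stab t|%:R *: p = c1 *: p + c2 *: p.
  apply: row_vec_inj; rewrite -e1 -e2 -mulmxDl -eab row_vec_antisym linearZ /= ep.
  by rewrite col_antisym_poly.
have stab (X : 'M_(dim (specht_mod C la))) q : mxmodule (specht_repr la) X ->
    (q <= X)%MS -> (q *m antisym_mx la t <= X)%MS.
  move=> /mxmoduleP modX qX; rewrite mulmx_sumr summx_sub // => s _.
  by rewrite -scalemxAr scalemx_sub // (submx_trans (submxMr _ qX)) ?modX ?inE.
have c12 : (c1 != 0) || (c2 != 0).
  rewrite -negb_and; apply: contra (card_col_stab_neq0 C t) => /andP[/eqP c10 /eqP c20].
  move: e; rewrite c10 c20 !scale0r addr0 => /eqP; rewrite scaler_eq0 (negPf p0) orbF.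
  by [].
have pX (X : 'M_(dim (specht_mod C la))) q c : mxmodule (specht_repr la) X ->
    q *m X *m antisym_mx la t = c *: p -> c != 0 -> row_full X.
  move=> modX eq c0; apply: (specht_submodule_full tt ep modX).
  by rewrite -[p](scalerK c0) -eq scalemx_sub ?stab ?submxMl.
case/orP: c12 => [|c20]; first exact: pX modU e1.
(* In the remaining case the complement is everything, so [U], meeting it trivially, is zero. *)
have Wfull := pX _ _ _ modW e2 c20.
case/eqP: U0; apply/eqP; rewrite -submx0; move/mxdirect_addsP: dUW => <-.
by rewrite sub_capmx submx_refl submx_full.
Qed.

(** An intertwiner commutes with the antisymmetrizer of a tableau of shape [la]. It carries the
    polytabloid to a vector of $S^\mu$ that the antisymmetrizer multiplies by a nonzero scalar,
    which forces equal shapes once the weights are ordered. *)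
Lemma specht_rsim_inj la mu : mx_rsim (specht_repr la) (specht_repr mu) -> la = mu.
Proof.
wlog lw : la mu / (weight la <= weight mu)%N.
  move=> h sim; have [/h|/ltnW/h h'] := leqP (weight la) (weight mu); first exact.
  by apply/esym/h'/mx_rsim_sym.
case=> B _ freeB homB.
have [t tt] := tableau_exists la; have [p ep p0] := polytabloid_row_vec tt.
apply: (col_antisym_specht_neq0 tt lw (row_vec_specht (p *m B))).
have homA : antisym_mx la t *m B = B *m antisym_mx mu t.
  rewrite mulmx_suml mulmx_sumr; apply: eq_bigr => s _.
  by rewrite -scalemxAl -scalemxAr homB ?inE.
rewrite -row_vec_antisym -mulmxA -homA mulmxA.
have -> : p *m antisym_mx la t = #|col_stab t|%:R *: p.
  by apply: row_vec_inj; rewrite row_vec_antisym linearZ /= ep col_antisym_poly.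
rewrite -scalemxAl linearZ scaler_eq0 negb_or card_col_stab_neq0 /=.
apply: contra p0 => /eqP pB0; apply/eqP/(row_free_inj freeB)/(@row_vec_inj mu).
by rewrite mul0mx linear0.
Qed.

End SpechtRepresentation.

(** * Conjugacy classes of the symmetric group *)

Section CycleDecomposition.
Variable T : finType.
Implicit Types (s : {perm T}) (x : T).

(** One point is taken per cycle. Sorting by length makes the list of cycle lengths nonincreasing,
    like the parts of a partition. *)
Definition cycle_reps s : seq T :=
  sort (fun x y => fingraph.order s y <= fingraph.order s x)%N (enum (froots s)).
Definition cycles s : seq (seq T) := [seq fingraph.orbit s x | x <- cycle_reps s].

Lemma map_orbit s x : map s (fingraph.orbit s x) = rot 1 (fingraph.orbit s x).
Proof.
rewrite /fingraph.orbit -orderSpred; set k := (fingraph.order s x).-1.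
have e : iter k s (s x) = x.
  by rewrite -iterSr /k orderSpred iter_order //; apply: perm_inj.
have -> : rot 1 (traject s x k.+1) = traject s (s x) k.+1.
  by rewrite [RHS]trajectSr e /= rot1_cons.
by elim: (k.+1) (x) => //= m IH y; rewrite IH.
Qed.

Lemma map_flatten_cycles s :
  map s (flatten (cycles s)) = flatten (map (rot 1) (cycles s)).
Proof.
rewrite map_flatten /cycles -!map_comp; congr flatten; apply: eq_map => x /=.
exact: map_orbit.
Qed.

(** A point lies only in the cycle of the root of its orbit, and that cycle is listed without
    repetition. *)
Lemma count_flatten_cycles s x : count_mem x (flatten (cycles s)) = 1%N.
Proof.
have cs := fconnect_sym (@perm_inj _ s).
have e r : froots s r -> count_mem x (fingraph.orbit s r) = (r == froot s x).
  move=> rr; rewrite count_uniq_mem ?orbit_uniq // -fconnect_orbit cs.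
  have er : froot s r = r by apply/eqP.
  by rewrite -(root_connect cs) er eq_sym.
rewrite count_flatten /cycles -map_comp sumnE big_map big_seq.
rewrite (eq_bigr (fun r => nat_of_bool (r == froot s x))) => [|r]; last first.
  by rewrite mem_sort mem_enum; apply: e.
rewrite -big_seq -(big_map (fun r => nat_of_bool (r == froot s x)) xpredT id) -sumnE.
rewrite sumn_count count_uniq_mem ?sort_uniq ?enum_uniq //.
by rewrite mem_sort mem_enum -topredE /= roots_root.
Qed.

Lemma flatten_cycles_uniq s : uniq (flatten (cycles s)).
Proof.
apply: count_mem_uniq => x; rewrite count_flatten_cycles -has_pred1 has_count.
by rewrite count_flatten_cycles.
Qed.

Lemma mem_flatten_cycles s x : x \in flatten (cycles s).
Proof. by rewrite -has_pred1 has_count count_flatten_cycles. Qed.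

Lemma size_flatten_cycles s : size (flatten (cycles s)) = #|T|.
Proof.
rewrite cardE; apply/perm_size/uniq_perm; rewrite ?flatten_cycles_uniq ?enum_uniq //.
by move=> x; rewrite mem_flatten_cycles mem_enum.
Qed.

(* Both permutations act on the concatenation of their cycles by the same
   rearrangement of positions, which depends only on the cycle lengths. *)
Lemma conj_of_cycle_shape s s' :
  shape (cycles s) = shape (cycles s') -> exists g, s' = (s ^ g)%g.
Proof.
move=> sh; pose w := flatten (cycles s); pose w' := flatten (cycles s').
pose f x := nth x w' (index x w).
have iw x : (index x w < size w')%N.
  by rewrite size_flatten_cycles -(size_flatten_cycles s) index_mem mem_flatten_cycles.
have fi : injective f.
  move=> x y /eqP; rewrite /f (set_nth_default y x) // nth_uniq ?flatten_cycles_uniq //.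
  move=> /eqP e; rewrite -(nth_index x (mem_flatten_cycles s x)) -/w e.
  by rewrite nth_index ?mem_flatten_cycles.
pose g := perm fi; exists g.
have gw : map g w = w'.
  have sw : size (map g w) = size w' by rewrite size_map !size_flatten_cycles.
  case ew : w' sw => [|x0 ?]; first by move/size0nil.
  rewrite -ew => sw; apply: (eq_from_nth (x0 := x0)) => // i; rewrite size_map => lti.
  rewrite (nth_map x0) // permE /f index_uniq ?flatten_cycles_uniq //.
  by apply: set_nth_default; rewrite -sw size_map.
have e : map s' (map g w) = map g (map s w).
  rewrite gw !map_flatten_cycles -[cycles s']flattenK -[cycles s]flattenK -/w -/w' -sh.
  rewrite map_flatten -gw -!map_reshape -!map_comp; congr flatten.
  by apply: eq_map => u; rewrite /= map_rot.
apply/permP=> y; have gx : y = g (g^-1%g y) by rewrite permKV.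
rewrite gx permJ; move: e; rewrite -!map_comp => /eq_in_map; apply.
exact: mem_flatten_cycles.
Qed.

End CycleDecomposition.

Section CycleType.
Variable n : nat.
Implicit Type s : 'S_n.

Definition cycle_lengths s : seq nat := shape (cycles s).

Lemma sumn_cycle_lengths s : sumn (cycle_lengths s) = n.
Proof. by rewrite -size_flatten size_flatten_cycles card_ord. Qed.

Lemma cycle_lengths_gt0 s k : k \in cycle_lengths s -> (0 < k)%N.
Proof.
by move=> /mapP[_ /mapP[x _ ->] ->]; rewrite size_orbit -orderSpred.
Qed.

Lemma cycle_lengths_sorted s : sorted geq (cycle_lengths s).
Proof.
rewrite /cycle_lengths /cycles /shape -map_comp sorted_map.
rewrite (eq_sorted (e' := fun x y => fingraph.order s y <= fingraph.order s x)%N); last first.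
  by move=> x y; rewrite /= !size_orbit.
by apply: sort_sorted => x y; apply: leq_total.
Qed.

Lemma size_cycle_lengths s : (size (cycle_lengths s) <= n)%N.
Proof.
rewrite -[leqRHS](sumn_cycle_lengths s); move: (@cycle_lengths_gt0 s).
elim: (cycle_lengths s) => //= k l IH h; rewrite -add1n leq_add ?h ?mem_head ?IH //.
by move=> j jl; apply: h; rewrite inE jl orbT.
Qed.

Definition cycle_type_fun s : {ffun 'I_n -> 'I_n.+1} :=
  [ffun i : 'I_n => inord (nth 0%N (cycle_lengths s) i)].

Lemma cycle_type_funE s i : cycle_type_fun s i = nth 0%N (cycle_lengths s) i :> nat.
Proof.
rewrite ffunE inordK // ltnS -[leqRHS](sumn_cycle_lengths s).
elim: (cycle_lengths s) (nat_of_ord i) => [|k l IH] [|j] //=; first exact: leq_addr.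
exact: leq_trans (IH j) (leq_addl _ _).
Qed.

Lemma cycle_type_intpart s : is_intpart (cycle_type_fun s).
Proof.
apply/andP; split.
  apply/forallP=> i; apply/forallP=> j; apply/implyP=> le_ij.
  rewrite !cycle_type_funE; have [lj|lj] := ltnP j (size (cycle_lengths s)).
    apply: (sorted_leq_nth _ _ _ (cycle_lengths_sorted s)) => //.
    - by move=> a b c /= ab bc; apply: leq_trans bc ab.
    - by move=> a; apply: leqnn.
    by rewrite inE (leq_ltn_trans le_ij).
  by rewrite nth_default.
apply/eqP; under eq_bigr => i _ do rewrite cycle_type_funE.
rewrite -[RHS](sumn_cycle_lengths s) sumnE (big_nth 0%N) big_mkord.
rewrite [RHS](big_ord_widen _ (fun i => nth 0%N (cycle_lengths s) i) (size_cycle_lengths s)).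
rewrite [RHS]big_mkcond; apply: eq_bigr => i _.
by case: ltnP => // h; rewrite nth_default.
Qed.

Definition cycle_type s : intpart n := IntPart (cycle_type_intpart s).

(** Cycles have positive length, so discarding the padding zeros recovers the list of lengths from
    the partition. *)
Lemma cycle_lengths_type s :
  cycle_lengths s = [seq k <- [seq nat_of_ord (cycle_type s i) | i <- enum 'I_n] | 0 < k]%N.
Proof.
have -> : [seq nat_of_ord (cycle_type s i) | i <- enum 'I_n]
    = mkseq (nth 0%N (cycle_lengths s)) n.
  by rewrite /mkseq -val_enum_ord -map_comp; apply: eq_map => i; rewrite /= cycle_type_funE.
have le := size_cycle_lengths s.
rewrite /mkseq -(subnKC le) iotaD map_cat -/(mkseq _ _) mkseq_nth filter_cat.
rewrite (all_filterP _); last by apply/allP=> k; apply: cycle_lengths_gt0.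
rewrite [X in _ ++ X](_ : _ = [::]) ?cats0 //.
apply/eqP; rewrite -[_ == _]negbK -has_filter; apply/hasPn => _ /mapP [i hi ->].
move: hi; rewrite mem_iota add0n => /andP[h _].
by rewrite nth_default.
Qed.

Lemma cycle_type_conj s s' : cycle_type s = cycle_type s' -> exists g, s' = (s ^ g)%g.
Proof.
move=> e; apply: conj_of_cycle_shape.
by rewrite -[LHS]/(cycle_lengths s) -[RHS]/(cycle_lengths s') !cycle_lengths_type e.
Qed.

(** Sending a class to the cycle type of its representative is injective, because permutations of
    equal cycle type are conjugate. *)
Lemma card_classes_Sym : (#|classes [set: 'S_n]| <= #|{: intpart n}|)%N.
Proof.
pose f (C : {set 'S_n}) := cycle_type (repr C).
rewrite -(card_in_imset (f := f)) ?max_card // => C D.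
move=> /imsetP[s _ ->] /imsetP[u _ ->] /cycle_type_conj[g e].
have [s' _ es] := repr_class [set: 'S_n]%G s.
have [u' _ eu] := repr_class [set: 'S_n]%G u.
rewrite es eu -conjgM in e; apply/class_eqP/imsetP.
exists (u' * (s' * g)^-1)%g; rewrite ?inE //.
by rewrite conjgM e conjgK.
Qed.

End CycleType.

(** * Wedderburn decomposition *)

Section WedderburnFamily.
Variables (F : closedFieldType) (gT : finGroupType) (G : {group gT}).
Variables (I : finType) (d : I -> nat).
Variable rG : forall i, mx_representation F G (d i).
Hypothesis F'G : ([pchar F]^'.-group G)%g.
Hypothesis irrG : forall i, mx_irreducible (rG i).
Hypothesis rG_inj : forall i j, mx_rsim (rG i) (rG j) -> i = j.

Let sG : irrType F G := DecSocleType (regular_repr F G).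
Let c i : sG := irr_comp sG (rG i).

Let c_inj : injective c.
Proof.
move=> i j e; apply: rG_inj.
have h k := rsim_irr_comp_pchar sG F'G (irrG k).
apply: mx_rsim_trans (h i) _; apply: mx_rsim_sym.
by rewrite -[irr_comp sG (rG i)]/(c i) e; apply: h.
Qed.

(** Over an algebraically closed field the enveloping algebra of an irreducible representation is
    the full matrix algebra, and it is already the image of the Wedderburn block of that
    representation. A preimage chosen in this block acts as zero on every other irreducible. *)
Lemma repr_family_surj i (A : 'M_(d i)) : exists a : gT -> F,
  \sum_(x in G) a x *: rG i x = A
  /\ (forall j, j != i -> \sum_(x in G) a x *: rG j x = 0).
Proof.
have /andP[_ fullE] := group_closure_closed_field (irrG i).
have : (A \in enveloping_algebra_mx (rG i))%MS by apply: submx_full.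
rewrite -(irr_comp_envelop_pchar sG F'G (irrG i)) => /submxP[u eA].
set B : 'M_#|G| := vec_mx (u *m Wedderburn_subring (c i)).
have RB : (B \in Wedderburn_subring (c i))%MS by rewrite vec_mxK submxMl.
have /envelop_mxP[a eB] : (B \in group_ring F G)%MS.
  by rewrite -(Wedderburn_sum_pchar sG F'G) (sumsmx_sup (c i)).
have opE j : gring_op (rG j) B = \sum_(x in G) a x *: rG j x.
  rewrite eB linear_sum; apply: eq_bigr => x Gx.
  by rewrite linearZ /= gring_opG.
exists a; split.
  rewrite -opE; apply: (can_inj mxvecK); rewrite eA mulmxA.
  by rewrite -[u *m _]vec_mxK mul_vec_lin.
move=> j ji; rewrite -opE; apply: (irr_comp'_op0_pchar F'G (irrG j) _ RB).
by rewrite eq_sym (inj_eq c_inj).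
Qed.

Hypothesis card_G : (#|classes G| <= #|I|)%N.

(** There are as many blocks as classes, so the injection [c] from the family into the blocks is
    onto. Each block acts faithfully on its own irreducible and by zero on the others, so an element
    acting by zero on the whole family has all its block components zero. *)
Lemma repr_family_inj (a : gT -> F) :
  (forall i, \sum_(x in G) a x *: rG i x = 0) -> {in G, forall x, a x = 0}.
Proof.
move=> a0; pose A := \sum_(x in G) a x *: regular_repr F G x.
have RA : (A \in group_ring F G)%MS by apply/envelop_mxP; exists a.
have opE j : gring_op (rG j) A = 0.
  rewrite -[RHS](a0 j) linear_sum; apply: eq_bigr => x Gx.
  by rewrite linearZ /= gring_opG.
have c_onto j : exists i, j = c i.
  have le : (#|sG| <= #|I|)%N.
    by rewrite (card_irr_pchar sG F'G) //; apply: group_closure_closed_field.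
  exact/codomP/(inj_card_onto c_inj le).
have A0 : A = 0.
  move: RA; rewrite -(Wedderburn_sum_pchar sG F'G) => /memmx_sumsP[B eA RB].
  rewrite eA big1 // => j _; have [i ej] := c_onto j.
  apply: (regular_op_inj_pchar F'G (irrG i)).
  - by rewrite inE /= -[irr_comp _ _]/(c i) -ej.
  - by rewrite inE /= mem0mx.
  rewrite linear0 -(opE i) eA linear_sum (bigD1 j) //= big1 ?addr0 // => k kj.
  apply: (irr_comp'_op0_pchar F'G (irrG i) _ (RB k)).
  by rewrite -[irr_comp _ _]/(c i) -ej.
(* The coefficients are recovered from the vanishing of [A] in the regular representation. *)
move=> x Gx; have /rowP/(_ 0) : gring_proj x A = 0 by rewrite A0 linear0.
rewrite linear_sum (bigD1 x) //= big1 => [|y /andP[Gy yx]].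
  by rewrite linearZ /= gring_projE // eqxx addr0 !mxE mulr1.
by rewrite linearZ /= gring_projE // eq_sym (negPf yx) scaler0.
Qed.

End WedderburnFamily.

(** * From the group algebra to the supermodules *)

Section Supermodules.
Variables (K : fieldType) (n : nat).
Implicit Type W : Sn_supermodule K n.

Definition sm_map W (x : Sn_superalg K n) : End_superalg W :=
  \sum_(s : 'S_n) (x : {ffun 'S_n -> K^o}) s *: sm_act W s.

Lemma sm_map_linear W : linear (sm_map W).
Proof.
move=> a x y; rewrite /sm_map scaler_sumr -big_split; apply: eq_bigr => s _ /=.
by rewrite !ffunE scalerDl scalerA.
Qed.

HB.instance Definition _ W :=
  GRing.isLinear.Build K (Sn_superalg K n) (End_superalg W) _ _ (@sm_map_linear W).

Lemma sm_map_of W s : sm_map W (SnA_of K s) = sm_act W s.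
Proof.
rewrite /sm_map (bigD1 s) //= big1 => [|u /negPf us].
  by rewrite ffunE eqxx scale1r addr0.
by rewrite ffunE us scale0r.
Qed.

Lemma sm_map1 W : sm_map W (sa_one _) = sa_one _.
Proof. by rewrite sm_map_of sm_act1. Qed.

Lemma sm_mapE W (x : Sn_superalg K n) v : (sm_map W x : 'End(W)) v =
  \sum_(s : 'S_n) (x : {ffun 'S_n -> K^o}) s *: sm_act W s v.
Proof. by rewrite sum_lfunE; apply: eq_bigr => s _; rewrite scale_lfunE. Qed.

Lemma sm_mapM W x y : sm_map W (sa_mul x y) = sa_mul (sm_map W x) (sm_map W y).
Proof.
apply/lfunP=> v; rewrite /= comp_lfunE linear_sum sum_lfunE sm_mapE; apply: eq_bigr => s _.
rewrite linear_sum sum_lfunE sm_mapE linear_sum scaler_sumr; apply: eq_bigr => t _.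
by rewrite linearZ /= sm_map_of scale_lfunE sm_actM comp_lfunE linearZ scalerA.
Qed.

Lemma sm_map_gr W b x : x \in sa_gr (Sn_superalg K n) b ->
  sm_map W x \in sa_gr (End_superalg W) b.
Proof.
rewrite inE => /forallP gx; apply/end_grP => a v Va; rewrite sm_mapE.
apply: memv_suml => s _; have := gx s; case: eqP => [->|_ /= /eqP <-].
  by rewrite scale0r mem0v.
by rewrite memvZ // sm_odd.
Qed.

End Supermodules.

Section SpechtMap.
Variables (C : numClosedFieldType) (n : nat).
Implicit Types (la mu : intpart n) (x : {ffun 'S_n -> C^o}).

Definition specht_map la x : 'End(specht_mod C la) :=
  \sum_(s : 'S_n) x s *: specht_act C la s.

Lemma specht_map_linear la : linear (specht_map la).
Proof.
move=> a x y; rewrite /specht_map scaler_sumr -big_split; apply: eq_bigr => s _ /=.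
by rewrite !ffunE scalerDl scalerA.
Qed.

HB.instance Definition _ la := GRing.isLinear.Build C {ffun 'S_n -> C^o}
  'End(specht_mod C la) _ _ (@specht_map_linear la).

Lemma specht_map_mx la x :
  end_mx (specht_map la x) = \sum_(s in [set: 'S_n]) x s *: specht_repr C la s.
Proof.
rewrite linear_sum; apply: eq_big => [s|s _]; first by rewrite inE.
by rewrite linearZ.
Qed.

Lemma specht_map_inj x : (forall la, specht_map la x = 0) -> x = 0.
Proof.
move=> x0; apply/ffunP=> s; rewrite ffunE.
have irr la := specht_irreducible C la; have sim la mu := @specht_rsim_inj C n la mu.
apply: (repr_family_inj (pchar_Sym C n) irr sim (card_classes_Sym n)); last by rewrite inE.
by move=> la; rewrite -specht_map_mx x0 linear0.
Qed.

Lemma specht_map_surj (I : finType) (p : I -> intpart n)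
    (g : forall i, 'End(specht_mod C (p i))) : injective p ->
  exists x, forall i, specht_map (p i) x = g i.
Proof.
move=> p_inj; have irr la := specht_irreducible C la.
have sim la mu := @specht_rsim_inj C n la mu.
have /fin_all_exists[x xP] i : exists x, specht_map (p i) x = g i
    /\ (forall mu, mu != p i -> specht_map mu x = 0).
  have [a [a1 a2]] := repr_family_surj (pchar_Sym C n) irr sim (end_mx (g i)).
  exists [ffun s => a s]; split=> [|mu /a2 a20]; apply: end_mx_inj.
    by rewrite specht_map_mx -a1; apply: eq_bigr => s _; rewrite ffunE.
  rewrite specht_map_mx linear0 -[RHS]a20; apply: eq_bigr => s _.
  by rewrite ffunE.
(* Each [x i] is concentrated on the shape [p i]; since the shapes are distinct, the summands do not
   interfere. *)
exists (\sum_i x i) => i; rewrite linear_sum (bigD1 i) //= big1 => [|j ji].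
  by rewrite addr0 (xP i).1.
by rewrite (xP j).2 // (inj_eq p_inj) eq_sym.
Qed.

End SpechtMap.

Section SpechtSupermodules.
Variables (C : numClosedFieldType) (n : nat) (ph : sgn_isos C n).
Implicit Types (la mu : intpart n) (x : {ffun 'S_n -> C^o}).

Lemma WE_mapE la x (w : WE_vect C la) : (sm_map (WE ph la) x : 'End(_)) w =
  (specht_map la x w.1, specht_map (conj_part la) x w.2).
Proof.
rewrite sm_mapE /specht_map !sum_lfunE.
rewrite [LHS]surjective_pairing; congr (_, _).
  rewrite (raddf_sum (fst : WE_vect C la -> _)); apply: eq_bigr => s _.
  by rewrite scale_lfunE /= WE_actE.
rewrite (raddf_sum (snd : WE_vect C la -> _)); apply: eq_bigr => s _.
by rewrite scale_lfunE /= WE_actE.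
Qed.

Lemma WE_map_comm la x : sm_map (WE ph la) x \in ssa_pred (QEnd_sub (WEJ ph la)).
Proof.
rewrite inE; apply/eqP/lfunP=> w; rewrite !comp_lfunE.
rewrite [LHS]WE_JE [X in _ = (sm_map _ _ : 'End(_)) X]WE_JE !WE_mapE /=.
by rewrite linearN.
Qed.

(** In the decomposition $S^\lambda\oplus S^{\lambda'}$ the involution is $\mathrm{diag}(1,-1)$.
    Commuting with it makes each off-diagonal component equal to its own negative, hence zero. *)
Lemma QEnd_WE_diag la (q : 'End(WE_space ph la)) :
    (q : End_superalg _) \in ssa_pred (QEnd_sub (WEJ ph la)) ->
  exists (a : 'End(specht_mod C la)) (b : 'End(specht_mod C (conj_part la))),
  forall w : WE_vect C la, q w = (a w.1, b w.2) :> WE_vect C la.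
Proof.
pose q' (w : WE_vect C la) : WE_vect C la := q w; rewrite inE => /eqP qJ.
have {}qJ w : q' (w.1, - w.2) = ((q' w).1, - (q' w).2).
  by have /lfunP/(_ w) := qJ; rewrite !comp_lfunE /= !WE_JE => /esym.
have q'l : linear q' by move=> k u v; rewrite /q' linearP.
have inlE k (u v : specht_mod C la) :
    ((k *: u + v, 0) : WE_vect C la) = k *: ((u, 0) : WE_vect C la) + (v, 0).
  by congr (_, _); rewrite /= scaler0 addr0.
have inrE k (u v : specht_mod C (conj_part la)) :
    ((0, k *: u + v) : WE_vect C la) = k *: ((0, u) : WE_vect C la) + (0, v).
  by congr (_, _); rewrite /= scaler0 addr0.
have al : linear (fun u => (q' (u, 0)).1) by move=> k u v; rewrite inlE q'l.
have bl : linear (fun u => (q' (0, u)).2) by move=> k u v; rewrite inrE q'l.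
exists (linfun (fun u => (q' (u, 0)).1)), (linfun (fun u => (q' (0, u)).2)).
have half (U : lmodType C) (u : U) : u = - u -> u = 0.
  by move/eqP; rewrite -addr_eq0 -mulr2n -scaler_nat scaler_eq0 pnatr_eq0 => /eqP.
have q'N w : q' (- w) = - q' w.
  by rewrite /q' linearN.
move=> [u v]; rewrite !linfunE_cond //= -[LHS]/(q' (u, v)).
have -> : q' (u, v) = q' (u, 0) + q' (0, v).
  by rewrite -[q' (u, 0)]scale1r -q'l; congr (q' (_, _)); rewrite /= scale1r ?addr0 ?add0r.
have := qJ (u, 0); have := qJ (0, v); rewrite /= oppr0.
have -> : ((0, - v) : WE_vect C la) = - ((0, v) : WE_vect C la).
  by congr (_, _); rewrite /= oppr0.
rewrite q'N => /(congr1 fst) /= /esym/half ev /(congr1 snd) /= /half eu.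
by rewrite [LHS]surjective_pairing /= ev eu addr0 add0r.
Qed.

End SpechtSupermodules.

(** * The partitions of [n] sorted into conjugate pairs and self-conjugate ones *)

Section Transversal.
Variables (n : nat) (Pbar : {set intpart n}).
Hypothesis tr : conj_transversal Pbar.

Lemma transversal_cover la : (la \in Pbar) || (conj_part la \in Pbar).
Proof.
have [/(_ la) h _] := tr; have : Pbar :&: [set la; conj_part la] != set0.
  by rewrite -card_gt0 h.
by case/set0Pn=> mu; rewrite !inE => /andP[h1 /orP[]/eqP <-]; rewrite h1 ?orbT.
Qed.

Lemma transversal_conj la mu : la \in Pbar -> mu \in Pbar -> conj_part la = mu -> la = mu.
Proof.
move=> laP muP e; have [/(_ la) h _] := tr; apply/eqP; apply: contraPT h => ne.
rewrite e (setIidPr _) ?cards2 ?ne //.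
by apply/subsetP=> nu; rewrite !inE => /orP[]/eqP ->.
Qed.

(** The Specht constituents of the modules $W^\lambda$: two for each element of $E_n$, one for each
    element of $F_n$. *)
Definition component_part (k : (Eidx Pbar + Eidx Pbar) + Fidx Pbar) : intpart n :=
  match k with
  | inl (inl e) => val e
  | inl (inr e) => conj_part (val e)
  | inr f => val f
  end.

Let EP (e : Eidx Pbar) : val e \in Pbar /\ conj_part (val e) <> val e.
Proof. by have := valP e; rewrite inE => /andP[? /eqP]. Qed.
Let FP (f : Fidx Pbar) : val f \in Pbar /\ conj_part (val f) = val f.
Proof. by have := valP f; rewrite inE => /andP[? /eqP]. Qed.

Lemma component_part_inj : injective component_part.
Proof.
(* The conjugate of a partition in $E_n$ lies outside [Pbar], since its class meets [Pbar] only
   once. *)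
have cross e mu : mu \in Pbar -> conj_part (val (e : Eidx Pbar)) = mu -> False.
  move=> muP h; have [eP ne] := EP e; apply: (ne).
  by rewrite h (transversal_conj eP muP h).
have ef (e : Eidx Pbar) (f : Fidx Pbar) : val e = val f -> False.
  by move=> h; have [_ ne] := EP e; have [_ eq] := FP f; rewrite h in ne.
have cc := can_inj (@conj_partK n).
move=> [[e|e]|f] [[e'|e']|f'] /=.
- by move/val_inj->.
- by move/esym/cross; case: (EP e) => eP _ /(_ eP).
- by move/ef.
- by move/cross; case: (EP e') => eP _ /(_ eP).
- by move/cc/val_inj->.
- by move/cross; case: (FP f') => fP _ /(_ fP).
- by move/esym/ef.
- by move/esym/cross; case: (FP f) => fP _ /(_ fP).
by move/val_inj->.
Qed.

Lemma component_part_onto la : exists k, la = component_part k.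
Proof.
have in_ mu : mu \in Pbar ->
    (exists e : Eidx Pbar, mu = val e) \/ (exists f : Fidx Pbar, mu = val f).
  move=> muP; have [e|e] := eqVneq (conj_part mu) mu; [right|left].
    have h : mu \in Fpart Pbar by rewrite inE muP e eqxx.
    by exists (exist _ mu h).
  have h : mu \in Epart Pbar by rewrite inE muP e.
  by exists (exist _ mu h).
case/orP: (transversal_cover la) => /in_ [[e ee]|[f ef]].
- by exists (inl (inl e)).
- by exists (inr f).
- by exists (inl (inr e)); rewrite /= -ee conj_partK.
by exists (inr f); rewrite /= -ef -[LHS]conj_partK ef (proj2 (FP f)).
Qed.

End Transversal.

Lemma inj_surj_bij (A : choiceType) (B : eqType) (f : A -> B) :
  injective f -> (forall y, exists x, f x = y) -> bijective f.
Proof.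
move=> f_inj f_surj; have ex y : exists x, f x == y.
  by have [x <-] := f_surj y; exists x.
exists (fun y => xchoose (ex y)) => [x|y]; last exact/eqP/(xchooseP (ex y)).
by apply/f_inj/eqP/(xchooseP (ex (f x))).
Qed.

(** * Matrix superalgebras *)

Section SuperalgebraIso.
Variable K : fieldType.

Lemma superalg_iso_dsum (I : finType) (A B : I -> superalg K) :
  (forall i, exists f : A i -> B i, superalg_iso f) ->
  exists f : dsum A -> dsum B, superalg_iso f.
Proof.
move=> /fin_all_exists[f fP].
pose F (x : dsum A) : dsum B := finfun (fun i => f i ((x : dsum_type A) i)).
exists F; split.
- move=> a x y; apply/ffunP=> i; have [lf _ _ _ _] := fP i.
  by rewrite !(dsum_addE, dsum_scaleE, ffunE) lf.
- by apply/ffunP=> i; rewrite !ffunE; have [_ -> _ _ _] := fP i.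
- by move=> x y; apply/ffunP=> i; rewrite !ffunE; have [_ _ -> _ _] := fP i.
- move=> b x; rewrite !inE => /forallP gx; apply/forallP=> i; rewrite ffunE.
  by have [_ _ _ gf _] := fP i; apply: gf.
have /fin_all_exists[g gP] i : exists g, cancel (f i) g /\ cancel g (f i).
  by have [_ _ _ _ [g K1 K2]] := fP i; exists g.
exists (fun y : dsum B => finfun (fun i => g i ((y : dsum_type B) i)) : dsum A).
  by move=> x; apply/ffunP=> i; rewrite !ffunE (proj1 (gP i)).
by move=> x; apply/ffunP=> i; rewrite !ffunE (proj2 (gP i)).
Qed.

Lemma superalg_iso_dsum2 (A B A' B' : superalg K) (f : A -> A') (g : B -> B') :
  superalg_iso f -> superalg_iso g ->
  superalg_iso (fun x : dsum2 A B => (f x.1, g x.2) : dsum2 A' B').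
Proof.
move=> [lf f1 fM fg [f' K1 K2]] [lg g1 gM gg [g' K1' K2']]; split.
- by move=> a x y; congr (_, _); [apply: lf | apply: lg].
- by rewrite /= f1 g1.
- by move=> x y; rewrite /= fM gM.
- by move=> b x; rewrite !inE => /andP[/fg ? /gg ?]; apply/andP.
by exists (fun y => (f' y.1, g' y.2)) => -[x y] /=; rewrite ?K1 ?K1' ?K2 ?K2'.
Qed.

Lemma superalg_iso_sub (A B : superalg K) (S : subsuperalg A) (S' : subsuperalg B)
    (f : A -> B) :
  superalg_iso f -> (forall x, (f x \in ssa_pred S') = (x \in ssa_pred S)) ->
  exists g : sub_superalg S -> sub_superalg S', superalg_iso g.
Proof.
move=> [lf f1 fM fg [f' K1 K2]] fS.
have Sf (x : ssa_type S) : f (ssa_val x) \in ssa_pred S' by rewrite fS; apply: valP.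
have Sf' (y : ssa_type S') : f' (ssa_val y) \in ssa_pred S.
  by rewrite -fS K2; apply: valP.
exists (fun x : ssa_type S => SsaElt (Sf x)); split.
- by move=> a x y; apply: val_inj; apply: lf.
- by apply: val_inj; apply: f1.
- by move=> x y; apply: val_inj; apply: fM.
- by move=> b x; rewrite !inE; apply: fg.
by exists (fun y : ssa_type S' => SsaElt (Sf' y)) => x; apply: val_inj; rewrite /= ?K1 ?K2.
Qed.

End SuperalgebraIso.

Lemma eq_mulmx_col (K : fieldType) m n (X Y : 'M[K]_(m, n)) :
  (forall c : 'cV_n, X *m c = Y *m c) -> X = Y.
Proof.
by move=> h; apply/trmx_inj/row_matrixP=> i; rewrite !rowE -[delta_mx 0 i]trmxK -!trmx_mul h.
Qed.

Lemma mulmx_submx_col (K : fieldType) m n (X : 'M[K]_(m + n)) (c : 'cV_(m + n)) :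
  X *m c = col_mx (ulsubmx X *m usubmx c + ursubmx X *m dsubmx c)
                  (dlsubmx X *m usubmx c + drsubmx X *m dsubmx c).
Proof. by rewrite -mul_block_col submxK vsubmxK. Qed.

(** * Graded coordinates and the matrix form of an endomorphism superalgebra *)

Section GradedCoordinates.
Variables (K : fieldType) (V : superspace K) (m n : nat).
Variables (k0 : {linear V -> 'cV[K]_m}) (l0 : {linear 'cV[K]_m -> V}).
Variables (k1 : {linear V -> 'cV[K]_n}) (l1 : {linear 'cV[K]_n -> V}).
Hypothesis l0V : forall c, l0 c \in sp_gr V false.
Hypothesis l1V : forall c, l1 c \in sp_gr V true.
Hypothesis l0K : cancel l0 k0.
Hypothesis l1K : cancel l1 k1.
Hypothesis k0K : {in sp_gr V false, cancel k0 l0}.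
Hypothesis k1K : {in sp_gr V true, cancel k1 l1}.

Let p0 : 'End(V) := daddv_pi (sp_gr V false) (sp_gr V true).
Let p1 : 'End(V) := daddv_pi (sp_gr V true) (sp_gr V false).

Let cap10 : (sp_gr V true :&: sp_gr V false = 0)%VS.
Proof. by rewrite capvC (sp_cap V). Qed.
Let p0V v : p0 v \in sp_gr V false. Proof. exact: memv_pi. Qed.
Let p1V v : p1 v \in sp_gr V true. Proof. exact: memv_pi. Qed.
Let p01 v : p0 v + p1 v = v.
Proof. by apply: (daddv_pi_add (sp_cap V)); rewrite sp_add memvf. Qed.
Let p0_id v : v \in sp_gr V false -> p0 v = v.
Proof. exact: (daddv_pi_id (sp_cap V)). Qed.
Let p1_id v : v \in sp_gr V true -> p1 v = v.
Proof. exact: (daddv_pi_id cap10). Qed.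
Let p0_0 v : v \in sp_gr V true -> p0 v = 0.
Proof. by move=> Vv; apply: (addIr (p1 v)); rewrite p01 add0r p1_id. Qed.
Let p1_0 v : v \in sp_gr V false -> p1 v = 0.
Proof. by move=> Vv; apply: (addrI (p0 v)); rewrite p01 addr0 p0_id. Qed.

(** The coordinates on the two homogeneous parts are parameters: for the full endomorphism
    superalgebra they are chosen independently, for the queer one they are related by the odd
    involution. *)
Definition gr_coord (v : V) : 'cV[K]_(m + n) := col_mx (k0 (p0 v)) (k1 (p1 v)).
Definition gr_vect (c : 'cV[K]_(m + n)) : V := l0 (usubmx c) + l1 (dsubmx c).

Lemma gr_coord_linear : linear gr_coord.
Proof. by move=> a u v; rewrite /gr_coord !linearP scale_col_mx add_col_mx. Qed.
Lemma gr_vect_linear : linear gr_vect.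
Proof. by move=> a u v; rewrite /gr_vect !linearP scalerDr addrACA. Qed.
HB.instance Definition _ := GRing.isLinear.Build K V _ _ gr_coord gr_coord_linear.
HB.instance Definition _ := GRing.isLinear.Build K _ V _ gr_vect gr_vect_linear.

Lemma gr_coordK : cancel gr_coord gr_vect.
Proof. by move=> v; rewrite /gr_vect col_mxKu col_mxKd k0K // k1K // p01. Qed.

Lemma gr_vectK : cancel gr_vect gr_coord.
Proof.
move=> c; rewrite /gr_coord /gr_vect !linearD /= (p0_id (l0V _)) (p1_id (l1V _)).
by rewrite (p0_0 (l1V _)) (p1_0 (l0V _)) !linear0 addr0 add0r l0K l1K vsubmxK.
Qed.

Lemma gr_coord0 v : (v \in sp_gr V false) = (dsubmx (gr_coord v) == 0).
Proof.
rewrite col_mxKd; apply/idP/eqP => [/p1_0 ->|e]; first by rewrite linear0.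
by rewrite -(p01 v) -(k1K (p1V v)) e linear0 addr0.
Qed.

Lemma gr_coord1 v : (v \in sp_gr V true) = (usubmx (gr_coord v) == 0).
Proof.
rewrite col_mxKu; apply/idP/eqP => [/p0_0 ->|e]; first by rewrite linear0.
by rewrite -(p01 v) -(k0K (p0V v)) e linear0 add0r.
Qed.

(** [lin1_mx] describes maps of row vectors. The transpositions turn this into the action on
    columns, so that composition becomes the matrix product in the same order. *)
Definition End_to_mx (f : End_superalg V) : Mat_superalg K m n :=
  (lin1_mx (fun r : 'rV_(m + n) => (gr_coord ((f : 'End(V)) (gr_vect r^T)))^T))^T.

Lemma End_to_mxE (f : 'End(V)) (c : 'cV_(m + n)) :
  (End_to_mx f : 'M_(m + n)) *m c = gr_coord (f (gr_vect c)).
Proof.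
pose g (r : 'rV[K]_(m + n)) := (gr_coord (f (gr_vect r^T)))^T.
have lg : linear g by move=> a u v; rewrite /g !linearP.
pose gl : {linear 'rV[K]_(m + n) -> 'rV[K]_(m + n)} :=
  HB.pack g (GRing.isLinear.Build K _ _ _ g lg).
apply: trmx_inj; rewrite trmx_mul trmxK; have := mul_rV_lin1 gl c^T.
by rewrite /= /g !trmxK.
Qed.

Lemma End_to_mx_coord (f : 'End(V)) v :
  (End_to_mx f : 'M_(m + n)) *m gr_coord v = gr_coord (f v).
Proof. by rewrite End_to_mxE gr_coordK. Qed.

Lemma End_to_mx_iso : superalg_iso End_to_mx.
Proof.
split.
- move=> a f g; apply: eq_mulmx_col => c; rewrite mulmxDl -scalemxAl !End_to_mxE.
  by rewrite add_lfunE scale_lfunE linearP.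
- by apply: eq_mulmx_col => c; rewrite End_to_mxE id_lfunE gr_vectK mul1mx.
- by move=> f g; apply: eq_mulmx_col => c; rewrite /= -mulmxA !End_to_mxE comp_lfunE gr_coordK.
- move=> b f /end_grP gf.
  (* Homogeneous vectors isolate one block column; the parity of their image annihilates one of its
     two blocks. *)
  have v0 (c : 'cV_m) : gr_vect (col_mx c 0) \in sp_gr V false.
    by rewrite gr_coord0 gr_vectK col_mxKd.
  have v1 (c : 'cV_n) : gr_vect (col_mx 0 c) \in sp_gr V true.
    by rewrite gr_coord1 gr_vectK col_mxKu.
  have h0 c := gf _ _ (v0 c); have h1 c := gf _ _ (v1 c).
  by case: b h0 h1 {gf} => /= h0 h1; rewrite inE; apply/andP; split; apply/eqP/eq_mulmx_col => c;
    rewrite mul0mx; (move: (h0 c) + move: (h1 c));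
    rewrite ?gr_coord0 ?gr_coord1 -End_to_mxE mulmx_submx_col !(col_mxKu, col_mxKd) mulmx0
      ?addr0 ?add0r => /eqP.
have linv (X : 'M[K]_(m + n)) : linear (fun v => gr_vect (X *m gr_coord v)).
  by move=> a u v; rewrite !linearP.
exists (fun X : 'M[K]_(m + n) => linfun (fun v => gr_vect (X *m gr_coord v)) : 'End(V)).
  by move=> f; apply/lfunP=> v; rewrite linfunE_cond // End_to_mx_coord gr_coordK.
by move=> X; apply: eq_mulmx_col => c; rewrite End_to_mxE linfunE_cond // !gr_vectK.
Qed.

End GradedCoordinates.

Section SubspaceCoordinates.
Variables (K : fieldType) (V : vectType K) (U : {vspace V}).

Definition sub_coord (v : V) : 'cV[K]_(\dim U) := \col_i coord (vbasis U) i v.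
Definition sub_vect (c : 'cV[K]_(\dim U)) : V := \sum_i c i 0 *: (vbasis U)`_i.

Lemma sub_coord_linear : linear sub_coord.
Proof. by move=> a u v; apply/colP=> i; rewrite !mxE linearP. Qed.
Lemma sub_vect_linear : linear sub_vect.
Proof.
move=> a u v; rewrite /sub_vect scaler_sumr -big_split; apply: eq_bigr => i _ /=.
by rewrite !mxE scalerDl scalerA.
Qed.
HB.instance Definition _ := GRing.isLinear.Build K V _ _ sub_coord sub_coord_linear.
HB.instance Definition _ := GRing.isLinear.Build K _ V _ sub_vect sub_vect_linear.

Lemma sub_vect_mem c : sub_vect c \in U.
Proof. by apply: memv_suml => i _; rewrite memvZ // vbasis_mem // mem_nth ?size_tuple. Qed.

Lemma sub_vectK : cancel sub_vect sub_coord.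
Proof.
move=> c; apply/colP=> i; rewrite mxE coord_sum_free //.
exact: basis_free (vbasisP U).
Qed.

Lemma sub_coordK : {in U, cancel sub_coord sub_vect}.
Proof.
move=> v Uv; rewrite [RHS](coord_vbasis Uv); apply: eq_bigr => i _.
by rewrite mxE.
Qed.

End SubspaceCoordinates.

Section MatrixForms.
Variables (K : fieldType) (V : superspace K).

Lemma End_superalg_mx m n : \dim (sp_gr V false) = m -> \dim (sp_gr V true) = n ->
  exists f : End_superalg V -> Mat_superalg K m n, superalg_iso f.
Proof.
move=> <- <-; eexists; apply: (End_to_mx_iso (k0 := sub_coord (sp_gr V false))
  (l0 := sub_vect (U := sp_gr V false)) (k1 := sub_coord (sp_gr V true))
  (l1 := sub_vect (U := sp_gr V true))).
- exact: sub_vect_mem.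
- exact: sub_vect_mem.
- exact: sub_vectK.
- exact: sub_vectK.
- exact: sub_coordK.
- exact: sub_coordK.
Qed.

(* [J] transports a basis of the even part to one of the odd part; in the
   resulting basis [J] is the block swap. *)
Lemma QEnd_superalg_mx (J : odd_involution V) m : \dim (sp_gr V false) = m ->
  exists f : QEnd_superalg J -> QMat_superalg K m, superalg_iso f.
Proof.
move=> <-; set m0 := \dim _.
pose l0 := [the {linear _ -> _} of sub_vect (U := sp_gr V false)].
pose k0 := [the {linear _ -> _} of sub_coord (sp_gr V false)].
pose k1 : {linear V -> 'cV[K]_m0} := (k0 \o oi_fun J)%FUN.
pose l1 : {linear 'cV[K]_m0 -> V} := (oi_fun J \o l0)%FUN.
have JJ v : oi_fun J (oi_fun J v) = v by rewrite -comp_lfunE oi_inv id_lfunE.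
have Jodd b v : v \in sp_gr V b -> oi_fun J v \in sp_gr V (~~ b).
  by move/(end_grP true (oi_fun J) (oi_odd J)); rewrite addbT.
have l0V c : l0 c \in sp_gr V false by apply: sub_vect_mem.
have l1V c : l1 c \in sp_gr V true by apply: (Jodd false); apply: sub_vect_mem.
have l0K : cancel l0 k0 by apply: sub_vectK.
have l1K : cancel l1 k1 by move=> c; rewrite /= JJ sub_vectK.
have k0K : {in sp_gr V false, cancel k0 l0} by apply: sub_coordK.
have k1K : {in sp_gr V true, cancel k1 l1}.
  by move=> v /Jodd Vv; rewrite /= sub_coordK.
apply: (superalg_iso_sub (End_to_mx_iso l0V l1V l0K l1K k0K k1K)) => f.
have JT c : oi_fun J (gr_vect l0 l1 c) = gr_vect l0 l1 (col_mx (dsubmx c) (usubmx c)).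
  by rewrite /gr_vect linearD /= JJ col_mxKu col_mxKd addrC.
have JC v : gr_coord k0 k1 (oi_fun J v) =
    col_mx (dsubmx (gr_coord k0 k1 v)) (usubmx (gr_coord k0 k1 v)).
  by rewrite -{1}(gr_coordK k0K k1K v) JT gr_vectK.
set X : 'M[K]_(m0 + m0) := End_to_mx k0 l0 k1 l1 f.
have XE v : gr_coord k0 k1 ((f : 'End(V)) v) = X *m gr_coord k0 k1 v.
  by rewrite (End_to_mx_coord k0K k1K).
rewrite !inE -/X; apply/andP/eqP => [[/eqP e1 /eqP e2] | e].
  apply/lfunP=> v; rewrite !comp_lfunE.
  apply: (can_inj (gr_coordK k0K k1K)); rewrite JC !XE JC.
  by rewrite !mulmx_submx_col !(col_mxKu, col_mxKd) e1 e2; congr col_mx; rewrite addrC.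
have h (c : 'cV_(m0 + m0)) : X *m col_mx (dsubmx c) (usubmx c) =
    col_mx (dsubmx (X *m c)) (usubmx (X *m c)).
  by rewrite !End_to_mxE -JT -JC -!comp_lfunE e.
have {}h (a b : 'cV_m0) :
    col_mx (ulsubmx X *m b + ursubmx X *m a) (dlsubmx X *m b + drsubmx X *m a) =
    col_mx (dlsubmx X *m a + drsubmx X *m b) (ulsubmx X *m a + ursubmx X *m b).
  by have := h (col_mx a b); rewrite !mulmx_submx_col !(col_mxKu, col_mxKd).
(* In the commutation relation with the block swap, [a = 0] compares the diagonal blocks and [b = 0]
   the off-diagonal ones. *)
split; apply/eqP/eq_mulmx_col => c.
  by have /eq_col_mx[+ _] := h 0 c; rewrite !mulmx0 addr0 add0r.
by have /eq_col_mx[+ _] := h c 0; rewrite !mulmx0 addr0 add0r.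
Qed.

End MatrixForms.

(** * The decomposition *)

Section SpechtDecomposition.
Variables (C : numClosedFieldType) (n : nat) (ph : sgn_isos C n).
Implicit Type la : intpart n.

Lemma dim_specht_mod la : \dim {: specht_mod C la} = \dim (specht C la).
Proof. by rewrite dimvf. Qed.

(** Each homogeneous part is the graph of $\pm\phi^\lambda$, hence a copy of $S^\lambda$. *)
Lemma dim_WE_gr la b : \dim (WE_gr ph la b) = \dim (specht C la).
Proof.
rewrite /WE_gr limg_dim_eq ?dim_specht_mod //.
apply/eqP; rewrite capfv -subv0; apply/subvP=> u; rewrite memv_ker memv0.
rewrite linfunE_cond => [/eqP[-> _] //|a v w].
by congr (_, _); rewrite linearP /= scalerDr !scalerA mulrC.
Qed.

Lemma dim_WF_gr la b : (2 <= n)%N -> conj_part la == la ->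
  \dim (WF_gr ph la b) = (\dim (specht C la))./2.
Proof.
move=> n2 sc; pose x0 : 'I_n := Ordinal (ltnW n2); pose x1 : 'I_n := Ordinal n2.
pose s := tperm x0 x1; have s_odd : odd_perm s by rewrite odd_tperm.
(* The transposition is odd and its own inverse, so it embeds each eigenspace in the other; both
   values of [a] together give equality. *)
have le a : (\dim (WF_gr ph la a) <= \dim (WF_gr ph la (~~ a)))%N.
  rewrite -(@limg_dim_eq _ _ _ (specht_act C la s)).
    apply/dimvS/subvP=> _ /memv_imgP[u Vu ->].
    by have := WF_odd (ph := ph) (sc := sc) s Vu; rewrite s_odd addbT.
  apply/eqP; rewrite -subv0; apply/subvP=> u; rewrite memv_cap memv_ker memv0.
  case/andP=> _ /eqP su0; apply/eqP; rewrite -[u]id_lfunE -(specht_act1 C la).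
  have -> : 1%g = Defs.pcomp s s by rewrite /Defs.pcomp tperm2.
  by rewrite specht_actM comp_lfunE su0 linear0.
have [d dE] : exists d : bool -> nat, forall a, \dim (WF_gr ph la a) = d a by eexists.
have {}le a : (d a <= d (~~ a))%N by rewrite -!dE.
have e : d true = d false by apply/eqP; rewrite eqn_leq (le true) (le false).
have <- : (d false + d true = \dim (specht C la))%N.
  rewrite -!dE; apply: etrans (dim_specht_mod la); rewrite -(WF_add ph sc).
  exact/esym/(dimv_disjoint_sum (WF_cap ph la)).
rewrite dE e addnn doubleK; by case: b.
Qed.

Variable Pbar : {set intpart n}.

Lemma QEndW_superalg_mx : (2 <= n)%N ->
  exists Psi : QEndW ph Pbar -> QMatW C Pbar, superalg_iso Psi.
Proof.
move=> n2.
have [f fP] : exists f : dsum (fun e : Eidx Pbar => QEnd_superalg (WEJ ph (val e))) ->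
    dsum (fun e : Eidx Pbar => QMat_superalg C (\dim (specht C (val e)))),
    superalg_iso f.
  by apply: superalg_iso_dsum => e; apply: QEnd_superalg_mx; apply: dim_WE_gr.
have [g gP] : exists g : dsum (fun f : Fidx Pbar =>
    End_superalg (WF ph (Fidx_conj f))) -> dsum (fun f : Fidx Pbar =>
    Mat_superalg C (\dim (specht C (val f)))./2 (\dim (specht C (val f)))./2),
    superalg_iso g.
  apply: superalg_iso_dsum => k; apply: End_superalg_mx; apply: dim_WF_gr => //;
    exact: Fidx_conj.
by exists (fun x => (f x.1, g x.2)); apply: superalg_iso_dsum2.
Qed.

Lemma Sn_superalg_decomposition : conj_transversal Pbar ->
  exists Phi : Sn_superalg C n -> QEndW ph Pbar,
    superalg_iso Phi /\
    forall s : 'S_n, QEndW_incl (Phi (SnA_of C s)) = W_map ph Pbar s.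
Proof.
move=> tr.
pose Phi1 (x : Sn_superalg C n) :
    dsum (fun e : Eidx Pbar => QEnd_superalg (WEJ ph (val e))) :=
  finfun (fun e => SsaElt (WE_map_comm ph (val e) x)
    : QEnd_superalg (WEJ ph (val e))).
pose Phi2 (x : Sn_superalg C n) :
    dsum (fun f : Fidx Pbar => End_superalg (WF ph (Fidx_conj f))) :=
  finfun (fun f => sm_map (WF ph (Fidx_conj f)) x).
exists (fun x => (Phi1 x, Phi2 x)); split; last first.
  move=> s; apply/ffunP=> -[e|f]; rewrite [LHS]ffunE [RHS]ffunE.
    rewrite [(Phi1 _ : dsum_type _) e]ffunE.
    exact: (sm_map_of (WE ph (val e))).
  rewrite [(Phi2 _ : dsum_type _) f]ffunE.
  exact: (sm_map_of (WF ph (Fidx_conj f))).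
split.
- move=> a x y; congr (_, _); apply/ffunP=> k;
    rewrite !(dsum_addE, dsum_scaleE, ffunE); last exact: sm_map_linear.
  by apply: val_inj; apply: sm_map_linear.
- congr (_, _); apply/ffunP=> k; rewrite !ffunE; last exact: sm_map1.
  by apply: val_inj; apply: sm_map1.
- move=> x y; congr (_, _); apply/ffunP=> k; rewrite !ffunE; last exact: sm_mapM.
  by apply: val_inj; apply: sm_mapM.
- move=> b x gx; rewrite inE; apply/andP; split; rewrite inE; apply/forallP=> k.
    rewrite [(Phi1 x : dsum_type _) k]ffunE inE.
    exact: (sm_map_gr (WE ph (val k)) gx).
  rewrite [(Phi2 x : dsum_type _) k]ffunE.
  exact: (sm_map_gr (WF ph (Fidx_conj k)) gx).
(* An element acting by zero on every $W^\lambda$ acts by zero on all constituents, seen on the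
   vectors [(u, 0)] and [(0, u)] when $\lambda\in E_n$; these constituents exhaust the Specht
   modules. *)
have Phi0 x : Phi1 x = 0 -> Phi2 x = 0 -> x = 0.
  move=> x1 x2; apply: specht_map_inj => la; have [k ->] := component_part_onto tr la.
  case: k => [[e|e]|f] /=.
  - apply/lfunP=> u.
    have : ssa_val ((Phi1 x : dsum_type _) e) = 0 by rewrite x1 dsum_0E.
    rewrite ffunE => /lfunP/(_ ((u, 0) : WE_vect C (val e))).
    by rewrite WE_mapE !zero_lfunE => /(congr1 fst).
  - apply/lfunP=> u.
    have : ssa_val ((Phi1 x : dsum_type _) e) = 0 by rewrite x1 dsum_0E.
    rewrite ffunE => /lfunP/(_ ((0, u) : WE_vect C (val e))).
    by rewrite WE_mapE !zero_lfunE => /(congr1 snd).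
  have : (Phi2 x : dsum_type _) f = 0 by rewrite x2 dsum_0E.
  by rewrite ffunE.
apply: inj_surj_bij.
  move=> x y [e1 e2]; apply/eqP; rewrite -subr_eq0; apply/eqP/Phi0; apply/ffunP=> k.
    rewrite dsum_0E ffunE; apply: val_inj; rewrite /= linearB /=; apply/eqP; rewrite subr_eq0.
    by move/ffunP/(_ k): e1; rewrite !ffunE => -[->].
  rewrite dsum_0E ffunE /= linearB /=; apply/eqP; rewrite subr_eq0.
  by move/ffunP/(_ k): e2; rewrite !ffunE => ->.
move=> [y1 y2].
have /fin_all_exists[a /fin_all_exists[b ab]] (e : Eidx Pbar) :=
  QEnd_WE_diag (valP ((y1 : dsum_type _) e)).
(* The target is split into independent endomorphisms of distinct Specht modules, all of which one
   element of the group algebra realizes at once. *)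
pose g (k : (Eidx Pbar + Eidx Pbar) + Fidx Pbar) : 'End(specht_mod C (component_part k)) :=
  match k return 'End(specht_mod C (component_part k)) with
  | inl (inl e) => a e
  | inl (inr e) => b e
  | inr f => (y2 : dsum_type _) f
  end.
have [x xP] := specht_map_surj g (component_part_inj tr).
exists x; congr (_, _); apply/ffunP=> k; rewrite ffunE; last exact: (xP (inr k)).
apply: val_inj; apply/lfunP=> w; rewrite [LHS]WE_mapE [RHS]ab.
by rewrite (xP (inl (inl k))) (xP (inl (inr k))).
Qed.

End SpechtDecomposition.

Theorem corollary3p1p8 (R : realType) (n : nat) (Pbar : {set intpart n})
    (ph : sgn_isos R[i] n) :
  (2 <= n)%N -> conj_transversal Pbar ->
  (exists Phi : Sn_superalg R[i] n -> QEndW ph Pbar,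
      superalg_iso Phi /\
      forall s : 'S_n,
        QEndW_incl (Phi (SnA_of R[i] s)) = W_map ph Pbar s)
  /\
  (exists Psi : QEndW ph Pbar -> QMatW R[i] Pbar, superalg_iso Psi).
Proof.
by move=> n2 tr; split; [apply: Sn_superalg_decomposition | apply: QEndW_superalg_mx].
Qed.
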